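(* Let $f\in\mathcal F$, i.e. let $f:\mathbb R^2\to\mathbb R$ be twice-continuously differentiable with bounded level sets and everywhere positive definite Hessian. If the restricted Nelder--Mead (RNM) algorithm is applied to $f$, starting from any nondegenerate triangle, then the algorithm converges to the unique minimizer of $f$.
   Context: $\mathcal F$ denotes the class of twice-continuously differentiable functions $f:\mathbb R^2\to\mathbb R$ with bounded level sets (each set $\{f\le c\}$ is bounded) and everywhere positive definite Hessian. The RNM algorithm in the plane. One iteration starts from a nondegenerate triangle and does the following. 1. (Order) Label the vertices so that $f(\mathbf p_1)\le f(\mathbf p_2)\le f(\mathbf p_3)$. 2. (Reflect) Let $\bar{\mathbf p}=\frac12(\mathbf p_1+\mathbf p_2)$ and $\mathbf p_{\rm r}=2\bar{\mathbf p}-\mathbf p_3$. If $f(\mathbf p_{\rm r})<f(\mathbf p_2)$, accept $\mathbf p_{\rm r}$ and end the iteration. 3. (Contract) Otherwise: (a) (outside contraction) if $f(\mathbf p_2)\le f(\mathbf p_{\rm r})<f(\mathbf p_3)$, let $\mathbf p_{\rm out}=\frac12(\bar{\mathbf p}+\mathbf p_{\rm r})$; if $f(\mathbf p_{\rm out})\le f(\mathbf p_{\rm r})$, accept $\mathbf p_{\rm out}$ and end the iteration, otherwise go to step 4; (b) (inside contraction) if $f(\mathbf p_{\rm r})\ge f(\mathbf p_3)$, let $\mathbf p_{\rm in}=\frac12(\bar{\mathbf p}+\mathbf p_3)$; if $f(\mathbf p_{\rm in})<f(\mathbf p_3)$, accept $\mathbf p_{\rm in}$ and end the iteration, otherwise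 go to step 4. 4. (Shrink) The vertices of the next triangle are $\mathbf p_1$, $\frac12(\mathbf p_1+\mathbf p_2)$, $\frac12(\mathbf p_1+\mathbf p_3)$. When a point is accepted it replaces $\mathbf p_3$; the other two vertices are kept. Tie-breaking: the initial triangle is ordered in any way consistent with its function values. After a non-shrink iteration the two retained vertices keep their relative order and the new vertex is placed after (ranked as worse than) any retained vertex with the same function value. After a shrink, if $\mathbf p_1$ is tied for best it remains the best vertex, and other ties are broken arbitrarily. If $\mathbf p_1^{(k)},\mathbf p_2^{(k)},\mathbf p_3^{(k)}$ are the vertices at the start of iteration $k$, the algorithm converges to $\mathbf z\in\mathbb R^2$ if $\lim_{k\to\infty}\mathbf p_i^{(k)}=\mathbf z$ for every $i\in\{1,2,3\}$. *)

(* Defs.v *)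
From HB Require Import structures.
From mathcomp Require Import all_boot all_order all_algebra.
From mathcomp Require Import all_classical all_reals all_analysis.

Set Implicit Arguments.
Unset Strict Implicit.
Unset Printing Implicit Defensive.

Import Order.TTheory GRing.Theory Num.Theory.
Import numFieldNormedType.Exports.

Local Open Scope classical_set_scope.
Local Open Scope ring_scope.

Section FunctionClass.
Context {R : realType}.
Implicit Types f : 'rV[R]_2 -> R.

(* The derivability clauses are needed: 'D_v f x is a junk value when the
   directional derivative does not exist. *)
Definition C1 f : Prop :=
  continuous f /\
  forall i : 'I_2,
    (forall x, derivable f x 'e_i) /\ continuous ('D_('e_i : 'rV[R]_2) f).

Definition C2 f : Prop :=
  C1 f /\ forall i : 'I_2, C1 ('D_('e_i : 'rV[R]_2) f).

Definition hessian f (x : 'rV[R]_2) : 'M[R]_2 :=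
  \matrix_(i, j) 'D_('e_j : 'rV[R]_2) ('D_('e_i : 'rV[R]_2) f) x.

Definition posdef (M : 'M[R]_2) : Prop :=
  forall v : 'rV[R]_2, v != 0 -> 0 < (v *m M *m v^T) 0 0.

Definition classF f : Prop :=
  [/\ C2 f,
      forall c : R, bounded_set [set x | f x <= c]
    & forall x, posdef (hessian f x)].

Definition minimizer f (z : 'rV[R]_2) : Prop := forall x, f z <= f x.

End FunctionClass.

(* The vertices are labelled: p1 is the best, p3 the worst. *)
Record triangle (R : realType) :=
  Triangle { p1 : 'rV[R]_2; p2 : 'rV[R]_2; p3 : 'rV[R]_2 }.

Section Algorithm.
Context {R : realType}.
Implicit Types (f : 'rV[R]_2 -> R) (t u : triangle R) (q : 'rV[R]_2).

Definition nondegenerate_triangle t : Prop :=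
  \det (col_mx (p2 t - p1 t) (p3 t - p1 t) : 'M[R]_2) != 0.

Definition ordered f t : Prop := f (p1 t) <= f (p2 t) <= f (p3 t).

Definition midpoint (x y : 'rV[R]_2) : 'rV[R]_2 := 2^-1 *: (x + y).

(* The point accepted by a reflection or contraction, or None when the
   iteration goes to the shrink step. *)
Definition accepted f t : option 'rV[R]_2 :=
  let pbar := midpoint (p1 t) (p2 t) in
  let pr := 2 *: pbar - p3 t in
  let pout := midpoint pbar pr in
  let pin := midpoint pbar (p3 t) in
  if f pr < f (p2 t) then Some pr
  else if f pr < f (p3 t) then
    if f pout <= f pr then Some pout else None
  else
    if f pin < f (p3 t) then Some pin else None.

(* [q] replaces p3 and is ranked after any retained vertex with the same
   value. *)
Definition replace_worst f t q : triangle R :=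
  if f q < f (p1 t) then Triangle q (p1 t) (p2 t)
  else if f q < f (p2 t) then Triangle (p1 t) q (p2 t)
  else Triangle (p1 t) (p2 t) q.

(* A relation, since ties other than for best are broken arbitrarily. *)
Definition shrink f t u : Prop :=
  let m2 := midpoint (p1 t) (p2 t) in
  let m3 := midpoint (p1 t) (p3 t) in
  [/\ perm_eq [:: p1 u; p2 u; p3 u] [:: p1 t; m2; m3],
      ordered f u
    & f (p1 t) <= f m2 -> f (p1 t) <= f m3 -> p1 u = p1 t].

Definition rnm_step f t u : Prop :=
  if accepted f t is Some q then u = replace_worst f t q else shrink f t u.

Definition rnm_run f (T : nat -> triangle R) : Prop :=
  [/\ nondegenerate_triangle (T 0%N),
      ordered f (T 0%N)
    & forall k, rnm_step f (T k) (T k.+1)].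

Definition rnm_converges_to (T : nat -> triangle R) (z : 'rV[R]_2) : Prop :=
  [/\ p1 (T k) @[k --> \oo] --> z,
      p2 (T k) @[k --> \oo] --> z
    & p3 (T k) @[k --> \oo] --> z].

End Algorithm.

(* Main.v *)
Require Import Defs.
From Stdlib Require Import ZArith.
From mathcomp Require Import all_boot all_order all_algebra.
From mathcomp Require Import all_classical all_reals all_analysis.
From mathcomp Require Import zify ssrZ ring lra.

(** Why the algorithm converges to the minimizer.

    Strict convexity rules out shrink steps, so every iteration either reflects
    the worst vertex through the midpoint of the other two or contracts. Up to
    exchanging the worst vertex with its reflection, a contraction moves the
    worst vertex halfway towards that midpoint ([rnm_step_kind]). A reflection
    yields a congruent triangle; a contraction halves the area and does not
    increase the diameter. Convexity alone then gives that contractions never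
    stop, that the three vertex values decrease to one limit [al] and that the
    diameters tend to 0 ([contracts_infinitely_often], [run_common_limit]). If
    [al] is the minimum of [f], the vertices converge to the minimizer.

    Assume that [al] exceeds the minimum. Then the gradient is bounded away
    from 0 along the run. Measure flatness by the ratio area^2 / diameter^6,
    written [det2 t / diam2 t ^+ 3]. Reflections preserve it. A contraction is
    possible only when the triangle lies along a level curve, with height of
    the order of diameter^2, so the ratio is bounded at contractions
    ([det2_upper]). The contradiction is that the ratio grows by a fixed
    factor: after each late contraction, some triangle at most 23 iterations
    later has a ratio larger by (101/100)^2 ([block_shape_growth]).

    The growth comes from a limiting model. With x the coordinate along the
    level curve in units of the width of the triangle, and y the suitably
    scaled normal coordinate, [f] is, up to an affine change of values and a
    small error, y + x^2. For that function, reflecting P3 through the midpoint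
    of P1 and P2 gives the value F1 + F2 - F3 + 2 (x3 - x1) (x3 - x2); hence
    only a vertex with extremal x can contract. Let m be the position of the
    middle vertex, the other end and the contracted vertex being at 0 and 1.
    The width after the contraction is max (m, (m + 2) / 4) and the area is
    halved, so for m < 0.79 the ratio has grown already. For m in [0.79, 1.01]
    one follows all continuations. Along a fixed sequence of moves every x is
    affine in m, and every value of y + x^2 is linear in 1, m, m^2, a, b, where
    a and b are two initial values. The comparisons made by the algorithm thus
    become linear inequalities in (m, m^2, a, b). A finite tree of cases, each
    closed by a narrow enough triangle or by a Farkas certificate of
    infeasibility, covers everything; [check] evaluates it, [check_sound]
    transfers it to actual runs whose values follow the model up to the error
    [margin], and [model_growth] is the outcome. *)

Set Implicit Arguments.
Unset Strict Implicit.
Unset Printing Implicit Defensive.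

Import Order.TTheory GRing.Theory Num.Theory.
Import numFieldNormedType.Exports.

Local Open Scope classical_set_scope.
Local Open Scope ring_scope.

(** * Second-order Taylor bounds in the plane *)

Section RealTaylor.
Context {R : realType}.

Lemma second_order_ge (g g1 g2 : R -> R) c :
  (forall t : R, is_derive t (1 : R) g (g1 t)) ->
    (forall t : R, is_derive t (1 : R) g1 (g2 t)) ->
  (forall t, 0 <= t <= 1 -> c <= g2 t) -> g 0 + g1 0 + c / 2 <= g 1.
Proof.
move=> dg dg1 hc.
have cont (h h1 : R -> R) : (forall t : R, is_derive t (1 : R) h (h1 t)) ->
    forall x y : R, {within `[x, y], continuous h}.
  move=> dh x y; apply: continuous_subspaceT => t.
  by apply/differentiable_continuous/derivable1_diffP; have [] := dh t.
have g1ge t : 0 <= t <= 1 -> g1 0 + c * t <= g1 t.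
  move=> /andP[t0 t1]; have [s] :=
    MVT_segment t0 (fun x _ => dg1 x) (cont _ _ dg1 0 t).
  rewrite in_itv/= => /andP[s0 s1] e.
  rewrite -lerBrDl e subr0 ler_wpM2r// hc// s0/=; exact: le_trans t1.
pose psi t := g t - (g1 0 * t + c / 2 * t ^+ 2).
have dpsi (t : R) : is_derive t (1 : R) psi (g1 t - (g1 0 + c * t)).
  rewrite /psi; have d1 := dg t; apply: is_derive_eq.
  by rewrite /GRing.scale/=; field.
have [s] := MVT_segment (@ler01 R) (fun x _ => dpsi x) (cont _ _ dpsi 0 1).
rewrite in_itv/= => hs; rewrite /psi => e.
have := g1ge _ hs; move: e; rewrite expr0n expr1n /=; lra.
Qed.

Lemma second_order_le (g g1 g2 : R -> R) c :
  (forall t : R, is_derive t (1 : R) g (g1 t)) ->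
    (forall t : R, is_derive t (1 : R) g1 (g2 t)) ->
  (forall t, 0 <= t <= 1 -> g2 t <= c) -> g 1 <= g 0 + g1 0 + c / 2.
Proof.
move=> dg dg1 hc.
have dN (h h1 : R -> R) : (forall t : R, is_derive t (1 : R) h (h1 t)) ->
    forall t : R, is_derive t (1 : R) (- h) ((- h1) t).
  by move=> dh t; have d := dh t; apply: is_derive_eq.
have hN t : 0 <= t <= 1 -> - c <= (- g2) t.
  by move=> /hc ht; rewrite -[leRHS]/(- g2 t) lerN2.
have : - g 0 + - g1 0 + - c / 2 <= - g 1.
  exact: (second_order_ge (dN _ _ dg) (dN _ _ dg1) hN).
lra.
Qed.

End RealTaylor.

Section Calculus.
Context {R : realType}.
Implicit Types (f : 'rV[R]_2 -> R) (x v w : 'rV[R]_2).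

Lemma partial_is_derive f x v t : (forall y, derivable f y v) ->
  is_derive (t : R) (1 : R) (fun s => f (x + s *: v)) ('D_v f (x + t *: v)).
Proof.
move=> df; have := df (x + t *: v); rewrite /derivable /derive => d.
have E :
    (fun h : R => h^-1 *: (((fun s => f (x + s *: v)) \o shift t)
       (h *: (1 : R)) - f (x + t *: v))) =
    (fun h : R => h^-1 *: ((f \o shift (x + t *: v)) (h *: v)
       - f (x + t *: v))).
  apply/funext => h; congr (_ *: (f _ - _)) => /=.
  by rewrite [h *: (1 : R)]mulr1 scalerDl addrCA.
by split; rewrite /derivable /derive E.
Qed.

Lemma partial_mvt f x v s : (forall y, derivable f y v) ->
  exists2 z, `|z| <= `|s| & f (x + s *: v) - f x = s * 'D_v f (x + z *: v).
Proof.
move=> df; pose g (t : R) := f (x + t *: v).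
have dg t : is_derive t (1 : R) g ('D_v f (x + t *: v)).
  exact: partial_is_derive.
have cg (a b : R) : {within `[a, b], continuous g}.
  apply: continuous_subspaceT => t.
  by apply/differentiable_continuous/derivable1_diffP; have [] := dg t.
have -> : f x = g 0 by rewrite /g scale0r addr0.
case: (leP 0 s) => s0.
  have [z] := MVT_segment s0 (fun y _ => dg y) (cg _ _).
  rewrite in_itv/= => /andP[z0 z1]; rewrite subr0 mulrC => e; exists z => //.
  by rewrite !ger0_norm.
have [z] := MVT_segment (ltW s0) (fun y _ => dg y) (cg _ _).
rewrite in_itv/= => /andP[z0 z1]; rewrite -/(g s) => e; exists z.
  by rewrite (ltr0_norm s0) ler0_norm// lerN2.
by rewrite -[LHS]opprB e; ring.
Qed.

Definition grad f x v : R := v 0 0 * 'D_('e_0) f x + v 0 1 * 'D_('e_1) f x.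

Lemma ord2E (i : 'I_2) : i = 0 \/ i = 1.
Proof. by case: i => [[|[|]]]// h; [left|right]; apply/val_inj. Qed.

Lemma row2_ext v w : v 0 0 = w 0 0 -> v 0 1 = w 0 1 -> v = w.
Proof. by move=> h0 h1; apply/rowP => i; case: (ord2E i) => ->. Qed.

Lemma row2_basis v : v = v 0 0 *: 'e_0 + v 0 1 *: 'e_1.
Proof. by apply: row2_ext; rewrite !mxE/= ?mulr1 ?mulr0 ?addr0 ?add0r. Qed.

(** The increment along [v] splits into one increment along each axis; the mean
    value theorem turns both into partial derivatives at points tending to [x],
    where the partial derivatives are continuous. *)
Lemma C1_derive f x v : C1 f -> is_derive x v f (grad f x v).
Proof.
move=> [_ hf]; have [d0 c0] := hf 0; have [d1 c1] := hf 1.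
suff h : (fun h : R => h^-1 *: ((f \o shift x) (h *: v) - f x)) @ 0^' --> grad
  f x v.
  by apply: DeriveDef; [apply/cvg_ex; exists (grad f x v)|apply: cvg_lim].
apply/cvgrPdist_le => e e0.
pose K := `|v 0 0| + `|v 0 1| + 1.
have K0 : 0 < K by rewrite /K ltr_wpDl// addr_ge0.
have eK : 0 < e / K by rewrite divr_gt0.
pose B := `|'e_0 : 'rV[R]_2| + `|'e_1 : 'rV[R]_2| + 1.
have B0 : 0 < B by rewrite /B ltr_wpDl// addr_ge0.
have near_x (g : 'rV[R]_2 -> R) : continuous g -> exists2 r, 0 < r & forall y,
    `|y - x| < r -> `|g x - g y| <= e / K.
  move=> cg; have /cvgrPdist_le/(_ _ eK) := cg x.
  by case/nbhs_ballP => r /= r0 hr; exists r => // y hy; apply: hr;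
    rewrite -ball_normE/= distrC.
have [r0 r0p h0] := near_x _ c0; have [r1 r1p h1] := near_x _ c1.
pose r := Num.min r0 r1 / (K * B).
have rp : 0 < r by rewrite divr_gt0 ?lt_min ?r0p// mulr_gt0.
near=> h.
have hr : `|h| < r by near: h; exact: dnbhs0_lt.
have hn0 : h != 0 by near: h; exact: nbhs_dnbhs_neq.
have hrs i : (i == r0) || (i == r1) -> `|h| * (K * B) < i.
  move: hr; rewrite ltr_pdivlMr ?mulr_gt0// lt_min => /andP[? ?].
  by case/orP => /eqP ->.
have [z0 z0h e0'] := partial_mvt x (h * v 0 0) d0.
have [z1 z1h e1'] := partial_mvt (x + (h * v 0 0) *: 'e_0) (h * v 0 1) d1.
have -> : (f \o shift x) (h *: v) - f x =
    h * v 0 1 * 'D_'e_1 f (x + (h * v 0 0) *: 'e_0 + z1 *: 'e_1) +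
    h * v 0 0 * 'D_'e_0 f (x + z0 *: 'e_0).
  rewrite -e0' -e1' /= (_ : h *: v + x =
    x + (h * v 0 0) *: 'e_0 + (h * v 0 1) *: 'e_1); first by ring.
  by rewrite {1}(row2_basis v) scalerDr !scalerA addrC addrA.
have v0K : `|v 0 0| <= K by rewrite /K -addrA lerDl addr_ge0.
have v1K : `|v 0 1| <= K by rewrite /K; have := normr_ge0 (v 0 0); lra.
have B1 : `|'e_0 : 'rV[R]_2| <= B by rewrite /B -addrA lerDl addr_ge0.
have D0 : `|'D_'e_0 f x - 'D_'e_0 f (x + z0 *: 'e_0)| <= e / K.
  apply: h0; rewrite addrC addKr normrZ; apply: le_lt_trans (hrs r0 _);
    last by rewrite eqxx.
  apply: le_trans (ler_wpM2r _ z0h) _ => //.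
  by rewrite normrM -mulrA ler_wpM2l// ler_pM.
have D1 : `|'D_'e_1 f x - 'D_'e_1 f (x + (h * v 0 0) *: 'e_0 + z1 *: 'e_1)| <=
  e / K.
  apply: h1; rewrite -(addrA x) (addrC x) addrK.
  apply: le_lt_trans (hrs r1 _); last by rewrite eqxx orbT.
  apply: le_trans (ler_normD _ _) _; rewrite !normrZ.
  apply: (@le_trans _ _ (`|h| * `|v 0 0| * `|'e_0 : 'rV[R]_2| + `|h| * `|v 0 1|
    * `|'e_1 : 'rV[R]_2|)).
    by apply: lerD; rewrite ler_wpM2r// -normrM.
  rewrite -!mulrA -mulrDr ler_wpM2l// /K /B.
  have := normr_ge0 (v 0 0); have := normr_ge0 (v 0 1).
  have := normr_ge0 ('e_0 : 'rV[R]_2); have := normr_ge0 ('e_1 : 'rV[R]_2).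
  by nra.
move: D0 D1; rewrite /grad.
move: ('D_'e_0 f (_ + _)) ('D_'e_1 f (_ + _)) ('D_'e_0 f x) ('D_'e_1 f x).
move=> A0 A1 a0 a1 D0 D1.
have -> : h^-1 *: (h * v 0 1 * A1 + h * v 0 0 * A0) = v 0 1 * A1 + v 0 0 * A0.
  by rewrite /GRing.scale/=; field.
have -> : v 0 0 * a0 + v 0 1 * a1 - (v 0 1 * A1 + v 0 0 * A0) =
   v 0 0 * (a0 - A0) + v 0 1 * (a1 - A1) by ring.
apply: le_trans (ler_normD _ _) _; rewrite !normrM.
apply: (@le_trans _ _ (`|v 0 0| * (e / K) + `|v 0 1| * (e / K))).
  by rewrite lerD// ler_wpM2l.
rewrite -mulrDl mulrCA -[leRHS]mulr1 ler_wpM2l ?(ltW e0)// ler_pdivrMr// mul1r.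
by rewrite /K lerDl.
Unshelve. all: by end_near. Qed.

Lemma line_is_derive f x v t : C1 f ->
  is_derive (t : R) (1 : R) (fun s => f (x + s *: v)) (grad f (x + t *: v) v).
Proof.
move=> hf; have D y := C1_derive y v hf.
rewrite -(@derive_val _ _ _ _ _ _ _ (D (x + t *: v))).
by apply: partial_is_derive => y; have [] := D y.
Qed.

Definition quad f x v : R := (v *m hessian f x *m v^T) 0 0.

Lemma quad_formE (M : 'M[R]_2) v : (v *m M *m v^T) 0 0 =
  v 0 0 * (v 0 0 * M 0 0 + v 0 1 * M 0 1) +
  v 0 1 * (v 0 0 * M 1 0 + v 0 1 * M 1 1).
Proof.
have sum2 (F : 'I_2 -> R) : \sum_i F i = F 0 + F 1.
  by rewrite big_ord_recl big_ord1; congr (F _ + F _); exact/val_inj.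
by rewrite mxE sum2 !mxE !sum2; ring.
Qed.

Lemma quadE f x v : quad f x v =
  v 0 0 * (v 0 0 * hessian f x 0 0 + v 0 1 * hessian f x 0 1) +
  v 0 1 * (v 0 0 * hessian f x 1 0 + v 0 1 * hessian f x 1 1).
Proof.
exact: quad_formE.
Qed.

Lemma line_is_derive2 f x v t : C2 f ->
  is_derive (t : R) (1 : R) (fun s => grad f (x + s *: v) v)
    (quad f (x + t *: v) v).
Proof.
move=> [_ hf]; rewrite /grad.
have d0 := line_is_derive x v t (hf 0); have d1 := line_is_derive x v t (hf 1).
rewrite quadE !mxE.
exact: (is_deriveD (is_deriveZ (v 0 0) d0) (is_deriveZ (v 0 1) d1)).
Qed.

Lemma taylor_ge f x v c : C2 f ->
  (forall t, 0 <= t <= 1 -> c <= quad f (x + t *: v) v) ->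
  f x + grad f x v + c / 2 <= f (x + v).
Proof.
move=> hf hc; have [hf1 _] := hf.
have := second_order_ge (fun t => line_is_derive x v t hf1)
  (fun t => line_is_derive2 x v t hf) hc.
by rewrite scale0r scale1r addr0.
Qed.

Lemma taylor_le f x v c : C2 f ->
  (forall t, 0 <= t <= 1 -> quad f (x + t *: v) v <= c) ->
  f (x + v) <= f x + grad f x v + c / 2.
Proof.
move=> hf hc; have [hf1 _] := hf.
have := second_order_le (fun t => line_is_derive x v t hf1)
  (fun t => line_is_derive2 x v t hf) hc.
by rewrite scale0r scale1r addr0.
Qed.

(** Heine's theorem, with one of the two points allowed outside the compact
    set, so that it applies to small steps leaving a ball. *)
Lemma uniform_on_compact (g : 'rV[R]_2 -> R) (K : set 'rV[R]_2) e :
  compact K -> continuous g -> 0 < e ->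
  exists2 r, 0 < r & forall x y, K x -> `|y - x| <= r -> `|g y - g x| <= e.
Proof.
move=> /compact_near_coveringP cK cg e0.
have := cK R (0^'+) (fun r x => forall y, `|y - x| <= r -> `|g y - g x| <= e) _.
case=> [x Kx|r /= r0 hr].
  have e2 : 0 < e / 2 by rewrite divr_gt0.
  have /cvgrPdist_le/(_ _ e2)/nbhs_ballP[d /= d0 hd] := cg x.
  have {}hd y : `|y - x| < d -> `|g x - g y| <= e / 2.
    by move=> hy; apply: hd; rewrite -ball_normE/= distrC.
  exists (ball x (d / 2), [set r | 0 < r < d / 2]) => /=.
    split; first by apply: nbhsx_ballx; rewrite divr_gt0.
    exists (d / 2) => /=; first by rewrite divr_gt0.
    by move=> r /=; rewrite sub0r normrN => /[swap] r0; rewrite gtr0_norm// r0.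
  move=> [x' r] /= [+ /andP[r0 rd]] y hy; rewrite -ball_normE/= distrC => hx'.
  have h1 : `|g x - g x'| <= e / 2 by apply: hd; lra.
  have h2 : `|g x - g y| <= e / 2.
    apply: hd; rewrite -(subrK x' y) -addrA;
      apply: le_lt_trans (ler_normD _ _) _; lra.
  rewrite -(subrK (g x) (g y)) -addrA; apply: le_trans (ler_normD _ _) _.
  by move: h2; rewrite distrC; lra.
exists (r / 2); first by rewrite divr_gt0.
move=> x y Kx; apply: (hr (r / 2)) => //=; last by rewrite divr_gt0.
by rewrite sub0r normrN gtr0_norm ?divr_gt0//; lra.
Qed.

Definition sqn v : R := v 0 0 ^+ 2 + v 0 1 ^+ 2.

Lemma sqn_ge0 v : 0 <= sqn v.
Proof. by rewrite addr_ge0 ?sqr_ge0. Qed.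

Lemma closed_ball_compact (rho : R) : compact [set x : 'rV[R]_2 | `|x| <= rho].
Proof.
apply: bounded_closed_compact.
  exists rho; split; first exact: num_real.
  by move=> y hy x /= hx; apply: le_trans hx (ltW hy).
apply: (@closed_comp _ _ (fun x : 'rV[R]_2 => `|x|) [set r | r <= rho]);
  last exact: closed_le.
by move=> x _; exact: norm_continuous.
Qed.

Lemma hessian_continuous f i j : C2 f -> continuous (fun x => hessian f x i j).
Proof.
move=> [_ /(_ i)[_ /(_ j)[_ c]]] x.
by rewrite (_ : (fun _ => _) = 'D_('e_j) ('D_('e_i) f))//; apply/funext => y;
  rewrite mxE.
Qed.

(** With [a], [b], [d] the entries of the symmetrized Hessian, the quadratic
    form multiplied by the trace [S] exceeds the determinant [D] times the
    squared norm by |Hv|^2 (Cayley-Hamilton), and it is at most the trace times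
    the squared norm. So the extrema of [D] and [S] on the ball suffice. *)
Lemma hessian_bounds f rho : 0 <= rho -> classF f ->
  exists mu M : R, [/\ 0 < mu, 0 < M & forall x v, `|x| <= rho ->
    mu * sqn v <= quad f x v <= M * sqn v].
Proof.
move=> rho0 [hf _ pd].
pose a x := hessian f x 0 0; pose d x := hessian f x 1 1.
pose b x := (hessian f x 0 1 + hessian f x 1 0) / 2.
have ca : continuous a by exact: hessian_continuous.
have cd : continuous d by exact: hessian_continuous.
have cb : continuous b.
  move=> x; apply: (@continuousM _ _ (fun x => hessian f x 0 1 + hessian f x 1
    0)
    (cst 2^-1)); last exact: cst_continuous.
  by apply: continuousD; exact: hessian_continuous.
have qE x v : quad f x v = a x * v 0 0 ^+ 2 + 2 * b x * (v 0 0 * v 0 1) + d x *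
  v 0 1 ^+ 2.
  by rewrite quadE /a /b /d; field.
have qge0 x v : 0 <= quad f x v.
  have [->|v0] := eqVneq v 0; first by rewrite qE !mxE; lra.
  exact/ltW/pd.
have qrow x (s t : R) : (s != 0) || (t != 0) ->
    0 < a x * s ^+ 2 + 2 * b x * (s * t) + d x * t ^+ 2.
  move=> st; pose v := \row_(i < 2) (if i == 0 then s else t).
  have [v0 v1] : v 0 0 = s /\ v 0 1 = t by rewrite !mxE.
  rewrite -v0 -v1 -qE; apply: pd; apply/negP => /eqP v00.
  by move: st; rewrite -v0 -v1 v00 !mxE eqxx.
have apos x : 0 < a x by have := qrow x 1 0; rewrite oner_eq0 => /(_ isT); lra.
have dpos x : 0 < d x by have := qrow x 0 1;
  rewrite oner_eq0 orbT => /(_ isT); lra.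
pose D x := a x * d x - b x * b x; pose S x := a x + d x.
have Dpos x : 0 < D x.
  (* At (-b, a) the form takes the value a (a d - b^2). *)
  have := qrow x (- b x) (a x); rewrite (gt_eqF (apos x)) orbT => /(_ isT).
  rewrite (_ : _ + _ = a x * D x); last by rewrite /D; ring.
  by rewrite pmulr_rgt0.
have cD : continuous D.
  move=> x; apply: (@continuousB _ _ _ (fun x => a x * d x) (fun x => b x * b
    x)).
    by apply: (@continuousM _ _ a d); [exact: ca|exact: cd].
  by apply: (@continuousM _ _ b b); exact: cb.
have cS : continuous S by move=> x; apply: (@continuousD _ _ _ a d);
  [exact: ca|exact: cd].
have K0 : [set x : 'rV[R]_2 | `|x| <= rho] !=set0 by exists 0 => /=;
  rewrite normr0.
have [x1 _ h1] := EVT_min_rV K0 (@closed_ball_compact rho)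
  (continuous_subspaceT cD).
have [x2 _ h2] := EVT_max_rV K0 (@closed_ball_compact rho)
  (continuous_subspaceT cS).
have Spos : 0 < S x2 by rewrite addr_gt0.
exists (D x1 / S x2), (S x2); split => //; first by rewrite divr_gt0.
move=> x v hx; have xK : x \in [set x : 'rV[R]_2 | `|x| <= rho] by rewrite inE.
have {}h1 := h1 _ xK; have {}h2 := h2 _ xK.
have s0 := sqn_ge0 v.
apply/andP; split.
  rewrite mulrAC ler_pdivrMr//.
  apply: (@le_trans _ _ (D x * sqn v)); first by rewrite ler_wpM2r.
  apply: (@le_trans _ _ (quad f x v * S x)); last by rewrite ler_wpM2l.
  rewrite -subr_ge0 qE (_ : _ - _ = (a x * v 0 0 + b x * v 0 1) ^+ 2 +
    (b x * v 0 0 + d x * v 0 1) ^+ 2); last by rewrite /S /D /sqn; ring.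
  by rewrite addr_ge0 ?sqr_ge0.
apply: (@le_trans _ _ (S x * sqn v)); last by rewrite ler_wpM2r.
pose w := \row_(i < 2) (if i == 0 then v 0 1 else - v 0 0) : 'rV[R]_2.
have [w0 w1] : w 0 0 = v 0 1 /\ w 0 1 = - v 0 0 by rewrite !mxE.
have := qge0 x w; rewrite !qE w0 w1 /S /sqn.
move: (a x) (b x) (d x) (v 0 0) (v 0 1) => A B E p q h.
rewrite -subr_ge0; apply: le_trans h _; rewrite le_eqVlt; apply/orP; left.
by apply/eqP; ring.
Qed.

End Calculus.

(** * Reflection and contraction of a triangle *)

Section TriangleShape.
Context {R : realType}.
Implicit Types (f : 'rV[R]_2 -> R) (t u : triangle R) (p q v w : 'rV[R]_2).

Definition reflection t : 'rV[R]_2 := 2 *: midpoint (p1 t) (p2 t) - p3 t.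

(** For [q] the worst vertex this is the inside contraction, and for [q] its
    reflection the outside one. *)
Definition contraction t q : 'rV[R]_2 := midpoint (midpoint (p1 t) (p2 t)) q.

Definition cross v w : R := v 0 0 * w 0 1 - v 0 1 * w 0 0.

(** Four times the squared area: squaring makes it independent of the order of
    the vertices. *)
Definition det2 t : R := cross (p2 t - p1 t) (p3 t - p1 t) ^+ 2.

(** For affine [h] this bounds the extent of the triangle in the direction of
    [h]. *)
Definition edge_bound (h : 'rV[R]_2 -> R) t (e : R) : Prop :=
  [/\ `|h (p1 t) - h (p2 t)| <= e, `|h (p1 t) - h (p3 t)| <= e
    & `|h (p2 t) - h (p3 t)| <= e].

Lemma replace_worstP f t q : f (p1 t) <= f (p2 t) ->
  let u := replace_worst f t q in
  [\/ f q < f (p1 t) /\ u = Triangle q (p1 t) (p2 t),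
      f (p1 t) <= f q < f (p2 t) /\ u = Triangle (p1 t) q (p2 t)
    | f (p2 t) <= f q /\ u = Triangle (p1 t) (p2 t) q].
Proof.
move=> h12 /=; rewrite /replace_worst.
case: ltP => [h|h1]; first by constructor 1.
by case: ltP => [h|h2]; [constructor 2|constructor 3].
Qed.

Lemma rnm_stepP f t u : accepted f t -> rnm_step f t u ->
  [\/ f (reflection t) < f (p2 t) /\ u = replace_worst f t (reflection t),
      [/\ f (p2 t) <= f (reflection t), f (p3 t) <= f (reflection t)
        & u = replace_worst f t (contraction t (p3 t))]
    | f (p2 t) <= f (reflection t) < f (p3 t) /\
      u = replace_worst f t (contraction t (reflection t))].
Proof.
rewrite /rnm_step /accepted -/(reflection t).
case: (ltP (f (reflection t))) => [h _ ->|h]; first by constructor 1.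
case: (ltP (f (reflection t))) => h3; case: ifP => // _ _ ->.
  by constructor 3.
by constructor 2.
Qed.

Lemma det2_insert f t q : det2 (replace_worst f t q) =
  cross (p2 t - p1 t) (q - p1 t) ^+ 2.
Proof.
rewrite /replace_worst /det2 /cross; do 2?case: ifP => _ /=; rewrite !mxE; ring.
Qed.

Lemma det2_reflection f t :
  det2 (replace_worst f t (reflection t)) = det2 t.
Proof.
by rewrite det2_insert /det2 /cross /reflection /midpoint !mxE; field.
Qed.

Lemma det2_contraction f t q : q = p3 t \/ q = reflection t ->
  det2 t = 4 * det2 (replace_worst f t (contraction t q)).
Proof.
by case=> ->; rewrite det2_insert /det2 /cross /contraction /reflection
  /midpoint !mxE; field.
Qed.

End TriangleShape.

(** * Strong convexity on a ball *)

Section Convexity.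
Context {R : realType}.
Variables (f : 'rV[R]_2 -> R) (rho mu M : R).
Implicit Types x y z v : 'rV[R]_2.

Lemma norm_segment x y (t : R) : `|x| <= rho -> `|y| <= rho -> 0 <= t <= 1 ->
  `|x + t *: (y - x)| <= rho.
Proof.
move=> hx hy /andP[t0 t1].
have -> : x + t *: (y - x) = (1 - t) *: x + t *: y.
  by apply: row2_ext; rewrite !mxE; ring.
apply: le_trans (ler_normD _ _) _; rewrite !normrZ (ger0_norm t0) ger0_norm;
  last lra.
have := ler_wpM2l t0 hy; have t1' : 0 <= 1 - t by lra.
have := ler_wpM2l t1' hx; lra.
Qed.

Hypothesis hf : C2 f.
Hypothesis curved : forall x v, `|x| <= rho ->
  mu * sqn v <= quad f x v <= M * sqn v.

(** Points of the ball lie above the tangent plane by at least [mu / 2] times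
    the squared distance. *)
Lemma above_tangent x y : `|x| <= rho -> `|y| <= rho ->
  f x + grad f x (y - x) + mu / 2 * sqn (y - x) <= f y.
Proof.
move=> hx hy; rewrite -[in leRHS](subrK x y) [in leRHS]addrC mulrAC.
by apply: taylor_ge => // t ht;
  have /andP[] := curved (y - x) (norm_segment hx hy ht).
Qed.

Lemma below_tangent x y : `|x| <= rho -> `|y| <= rho ->
  f y <= f x + grad f x (y - x) + M / 2 * sqn (y - x).
Proof.
move=> hx hy; rewrite -[in leLHS](subrK x y) [in leLHS]addrC mulrAC.
by apply: taylor_le => // t ht;
  have /andP[] := curved (y - x) (norm_segment hx hy ht).
Qed.

Lemma norm_midpoint x y : `|x| <= rho -> `|y| <= rho -> `|midpoint x y| <= rho.
Proof.
move=> hx hy; have h : 0 <= (2^-1 : R) <= 1 by apply/andP; split; lra.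
have := norm_segment hx hy h.
suff -> : x + 2^-1 *: (y - x) = midpoint x y by [].
by apply: row2_ext; rewrite /midpoint !mxE; field.
Qed.

(** Jensen's inequality with weights 1/4, 1/4, 1/2 and the gain given by strong
    convexity: the tangent bounds at the contracted point are averaged, and the
    gradient terms cancel. *)
Lemma contraction_value t q : 0 <= mu ->
  `|p1 t| <= rho -> `|p2 t| <= rho -> `|q| <= rho ->
  f (contraction t q) + mu / 32 * (sqn (p1 t - p2 t) + sqn (p1 t - q) + sqn (p2
    t - q))
    <= (f (p1 t) + f (p2 t)) / 4 + f q / 2.
Proof.
move=> mu0 h1 h2 hq; set n := contraction t q.
have hn : `|n| <= rho by apply: norm_midpoint => //; exact: norm_midpoint.
have := above_tangent hn h1; have := above_tangent hn h2;
  have := above_tangent hn hq.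
have n0 i : n 0 i = (p1 t 0 i + p2 t 0 i + 2 * q 0 i) / 4.
  by rewrite /n /contraction /midpoint !mxE; field.
clearbody n; rewrite /grad /sqn !mxE !n0.
move: ('D_'e_0 f n) ('D_'e_1 f n) (f n) (f q) (f (p1 t)) (f (p2 t)) => g0 g1 a
  b c d.
move: (p1 t 0 0) (p1 t 0 1) (p2 t 0 0) (p2 t 0 1) (q 0 0) (q 0 1).
move=> x0 x1 y0 y1 z0 z1 e1 e2 e3.
have e4 : 0 <= mu * ((x0 - z0) ^+ 2 + (x1 - z1) ^+ 2 + (y0 - z0) ^+ 2 + (y1 -
  z1) ^+ 2).
  by rewrite mulr_ge0// !addr_ge0 ?sqr_ge0.
lra.
Qed.

End Convexity.

(** * The two kinds of steps *)

Section SingleStep.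
Context {R : realType}.
Implicit Types (f : 'rV[R]_2 -> R) (t u : triangle R) (p q v w x : 'rV[R]_2).

Lemma det2_ge0 t : 0 <= det2 t.
Proof. exact: sqr_ge0. Qed.

Lemma sqnN v w : sqn (v - w) = sqn (w - v).
Proof. by rewrite -opprB /sqn !mxE !sqrrN. Qed.

Lemma sqn_eq0 v : sqn v = 0 -> v = 0.
Proof.
move=> /eqP; rewrite /sqn paddr_eq0 ?sqr_ge0// !sqrf_eq0 => /andP[/eqP h0 /eqP
  h1].
by apply: row2_ext; rewrite mxE.
Qed.

Lemma cross_le v w : cross v w ^+ 2 <= sqn v * sqn w.
Proof.
rewrite -subr_ge0 (_ : _ - _ = (v 0 0 * w 0 0 + v 0 1 * w 0 1) ^+ 2) ?sqr_ge0//.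
by rewrite /cross /sqn; ring.
Qed.

Definition diam2 t : R :=
  Num.max (sqn (p1 t - p2 t)) (Num.max (sqn (p1 t - p3 t)) (sqn (p2 t - p3 t))).

Lemma diam2_le t c : (diam2 t <= c) =
  [&& sqn (p1 t - p2 t) <= c, sqn (p1 t - p3 t) <= c & sqn (p2 t - p3 t) <= c].
Proof. by rewrite /diam2 !ge_max. Qed.

Lemma diam2_edges t : [/\ sqn (p1 t - p2 t) <= diam2 t,
  sqn (p1 t - p3 t) <= diam2 t & sqn (p2 t - p3 t) <= diam2 t].
Proof. by apply/and3P; rewrite -diam2_le. Qed.

Lemma diam2_ge0 t : 0 <= diam2 t.
Proof. by have [h _ _] := diam2_edges t; apply: le_trans h; exact: sqn_ge0. Qed.

Lemma det2_le_edge t : det2 t <= sqn (p1 t - p3 t) * diam2 t.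
Proof.
apply: le_trans (cross_le _ _) _; rewrite mulrC sqnN ler_wpM2l ?sqn_ge0//.
by rewrite sqnN; have [] := diam2_edges t.
Qed.

Lemma diam2_insert f t q :
  diam2 (replace_worst f t q) = diam2 (Triangle (p1 t) (p2 t) q).
Proof.
rewrite /replace_worst; do 2?case: ifP => _ //; rewrite /diam2 /=.
  by rewrite (sqnN q) (sqnN q) [RHS]maxC maxA.
by rewrite (sqnN q) maxCA.
Qed.

Lemma diam2_reflected t : diam2 (Triangle (p1 t) (p2 t) (reflection t)) = diam2
  t.
Proof.
rewrite /diam2 /=; congr Num.max.
have e1 : sqn (p1 t - reflection t) = sqn (p2 t - p3 t).
  by rewrite /sqn /reflection /midpoint !mxE; field.
have e2 : sqn (p2 t - reflection t) = sqn (p1 t - p3 t).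
  by rewrite /sqn /reflection /midpoint !mxE; field.
by rewrite e1 e2 maxC.
Qed.

Lemma diam2_contracted t :
  diam2 (Triangle (p1 t) (p2 t) (contraction t (p3 t))) <= diam2 t.
Proof.
have [e12 e13 e23] := diam2_edges t.
rewrite diam2_le /= e12 /=; move: e12 e13 e23; set d := diam2 t.
have : 0 <= sqn (p1 t - p2 t + (p1 t - p3 t)) by exact: sqn_ge0.
have : 0 <= sqn (p1 t - p2 t - (p2 t - p3 t)) by exact: sqn_ge0.
have : 0 <= sqn (p1 t - p2 t - (p1 t - p3 t)) by exact: sqn_ge0.
have : 0 <= sqn (p1 t - p2 t + (p2 t - p3 t)) by exact: sqn_ge0.
rewrite /sqn /contraction /midpoint !mxE.
move: (p1 t 0 0) (p1 t 0 1) (p2 t 0 0) (p2 t 0 1) (p3 t 0 0) (p3 t 0 1) d.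
move=> x0 x1 y0 y1 z0 z1 d h1 h2 h3 h4 e12 e13 e23; apply/andP; split; lra.
Qed.

Lemma ordered_replace_worst f t q : ordered f t ->
  ordered f (replace_worst f t q).
Proof.
move=> /andP[le12 le23]; rewrite /ordered.
case: (replace_worstP q le12) => -[h ->] /=; first by rewrite (ltW h).
  by case/andP: h => -> /ltW.
by rewrite le12.
Qed.

Lemma replace_worst_values f t q : f (p1 t) <= f (p2 t) ->
  let u := replace_worst f t q in
  [/\ f (p1 u) <= f q, f (p1 u) <= f (p1 t), f (p2 u) <= f (p2 t),
      f (p2 u) <= Num.max (f (p1 t)) (f q) &
      f (p3 u) = Num.max (f (p2 t)) (f q)].
Proof.
move=> le12 /=; case: (replace_worstP q le12) => -[h ->] /=.
- by rewrite (ltW h) le12 !le_max !lexx max_l// ltW// (lt_le_trans h).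
- case/andP: h => h h'; rewrite h (ltW h') le_max !lexx orbT.
  by rewrite max_l// ltW.
- by rewrite (le_trans le12 h) le_max h orbT !lexx max_r.
Qed.

(** A contraction is described through the point [q], the better of the worst
    vertex and its reflection. This makes inside and outside contractions the
    same move applied to the triangle [p1, p2, q]. *)
Definition reflects f t u : Prop :=
  f (reflection t) < f (p2 t) /\ u = replace_worst f t (reflection t).

Definition contracts f t u : Prop := exists q,
  [/\ q = p3 t \/ q = reflection t, f (p2 t) <= f q, f q <= f (p3 t),
      f q <= f (reflection (Triangle (p1 t) (p2 t) q)) &
      u = replace_worst f t (contraction t q)].

Lemma reflectionK t : reflection (Triangle (p1 t) (p2 t) (reflection t)) = p3 t.
Proof. by apply: row2_ext; rewrite /reflection /midpoint !mxE/=; field. Qed.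

Lemma rnm_step_kind f t u : ordered f t -> accepted f t -> rnm_step f t u ->
  reflects f t u \/ contracts f t u.
Proof.
move=> /andP[le12 le23] acc st;
  case: (rnm_stepP acc st) => [[h E]|[h h' E]|[/andP[h h'] E]].
- by left.
- by right; exists (p3 t); split => //; left.
- by right; exists (reflection t); rewrite reflectionK (ltW h'); split => //;
  right.
Qed.

Lemma reflects_shape f t u : reflects f t u ->
  det2 u = det2 t /\ diam2 u = diam2 t.
Proof. by case=> _ ->; rewrite det2_reflection diam2_insert diam2_reflected.
Qed.

Lemma contracts_shape f t u : contracts f t u ->
  det2 t = 4 * det2 u /\ diam2 u <= diam2 t.
Proof.
case=> q [hq _ _ _ ->]; split; first exact: det2_contraction.
rewrite diam2_insert; case: hq => ->; first exact: diam2_contracted.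
rewrite -(diam2_reflected t).
exact: (diam2_contracted (Triangle (p1 t) (p2 t) (reflection t))).
Qed.

(** Convexity excludes the shrink step: a contracted point lies strictly below
    the mean of values that are at most the one to beat. *)
Lemma accepted_classF f t : classF f -> ordered f t -> det2 t != 0 ->
  accepted f t.
Proof.
move=> cf /andP[le12 le23] nd; have [C2f _ _] := cf.
pose rho := Num.max (Num.max `|p1 t| `|p2 t|) (Num.max `|p3 t| `|reflection t|).
have rho0 : 0 <= rho by rewrite !le_max normr_ge0.
have [mu [M [mu0 _ curved]]] := hessian_bounds rho0 cf.
have n1 : `|p1 t| <= rho by rewrite !le_max lexx.
have n2 : `|p2 t| <= rho by rewrite !le_max lexx !orbT.
have n3 : `|p3 t| <= rho by rewrite !le_max lexx !orbT.
have nr : `|reflection t| <= rho by rewrite !le_max lexx !orbT.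
have mu32 : 0 < mu / 32 by lra.
rewrite /accepted -/(reflection t); case: ltP => // h2; case: ltP => h3.
  have := contraction_value C2f curved (ltW mu0) n1 n2 nr;
    rewrite -/(contraction t _).
  have := sqn_ge0 (p1 t - p2 t); have := sqn_ge0 (p1 t - reflection t).
  have := sqn_ge0 (p2 t - reflection t).
  move: (sqn _) (sqn _) (sqn _) => s1 s2 s3 s10 s20 s30.
  have s0 : 0 <= mu / 32 * (s3 + s2 + s1) by apply: mulr_ge0; lra.
  by move=> h; rewrite ifT//; lra.
have := contraction_value C2f curved (ltW mu0) n1 n2 n3;
  rewrite -/(contraction t _).
have s13 : 0 < sqn (p1 t - p3 t).
  rewrite lt_neqAle sqn_ge0 andbT eq_sym; apply: contra nd => /eqP s0.
  by have := det2_le_edge t; rewrite s0 mul0r => h; rewrite eq_le h sqr_ge0.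
have := sqn_ge0 (p1 t - p2 t); have := sqn_ge0 (p2 t - p3 t).
move: (sqn _) (sqn _) (sqn _) s13 => s1 s2 s3 s20 s10 s30.
have s0 : 0 < mu / 32 * (s2 + s3 + s1) by apply: mulr_gt0; lra.
by move=> h; rewrite ifT//; lra.
Qed.

End SingleStep.

(** * Limits along a run *)

Lemma det_mx2 (R : comPzRingType) (M : 'M[R]_2) :
  \det M = M 0 0 * M 1 1 - M 0 1 * M 1 0.
Proof.
rewrite (expand_det_row _ 0) big_ord_recl big_ord1 /cofactor !det_mx11 !mxE.
rewrite (_ : lift ord0 0 = 1); last exact/val_inj.
rewrite (_ : lift 1 0 = 0); last exact/val_inj.
by rewrite (_ : ord0 = 0)// expr0 expr1 mul1r mulN1r mulrN.
Qed.
Lemma nondegenerate_det2 (R : realType) (t : triangle R) :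
  nondegenerate_triangle t -> det2 t != 0.
Proof.
rewrite /nondegenerate_triangle det_mx2 /det2 sqrf_eq0.
have r0 (v w : 'rV[R]_2) j : col_mx v w (0 : 'I_2) j = v 0 j.
  by rewrite mxE; case: splitP => [k|k] //= _; rewrite (ord1 k).
have r1 (v w : 'rV[R]_2) j : col_mx v w (1 : 'I_2) j = w 0 j.
  by rewrite mxE; case: splitP => [[[]]|k] //= _; rewrite (ord1 k).
by rewrite !r0 !r1.
Qed.

Section Minimizer.
Context {R : realType}.
Variable f : 'rV[R]_2 -> R.
Hypothesis cf : classF f.

(** The case of [contraction_value] where two vertices coincide. *)
Lemma midpoint_value (rho mu M : R) x z :
  (forall y v, `|y| <= rho -> mu * sqn v <= quad f y v <= M * sqn v) ->
    0 <= mu ->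
  `|x| <= rho -> `|z| <= rho ->
  f (midpoint x z) + mu / 16 * sqn (x - z) <= (f x + f z) / 2.
Proof.
move=> curved mu0 hx hz; have [C2f _ _] := cf.
have := @contraction_value _ f rho mu M C2f curved (Triangle x x z) z mu0 hx hx
  hz.
rewrite /contraction /= (_ : midpoint x x = x); last first.
  by apply: row2_ext; rewrite /midpoint !mxE; field.
rewrite (_ : sqn (x - x) = 0); last by rewrite subrr /sqn !mxE; ring.
by lra.
Qed.

Lemma exists_minimizer : exists z, unique (minimizer f) z.
Proof.
have [C2f bnd _] := cf; have [[cont _] _] := C2f.
have cpt : compact [set x | f x <= f 0].
  apply: bounded_closed_compact; first exact: bnd.
  by apply: (@closed_comp _ _ f [set r | r <= f 0]); [move=> x _;
    exact: cont|exact: closed_le].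
have [z _ hz] : exists2 c, c \in [set x | f x <= f 0] &
    forall t, t \in [set x | f x <= f 0] -> f c <= f t.
  apply: EVT_min_rV => //; first by exists 0 => /=.
  exact: continuous_subspaceT.
have minz : minimizer f z.
  move=> x; have [hx|hx] := leP (f x) (f 0); first by apply: hz; rewrite inE.
  by apply: le_trans (ltW hx); apply: hz; rewrite inE /=.
exists z; split => // y miny.
pose rho := Num.max `|z| `|y|.
have rho0 : 0 <= rho by rewrite le_max normr_ge0.
have [mu [M [mu0 _ curved]]] := hessian_bounds rho0 cf.
have hz' : `|z| <= rho by rewrite le_max lexx.
have hy' : `|y| <= rho by rewrite le_max lexx orbT.
have := midpoint_value curved (ltW mu0) hz' hy'.
have := minz (midpoint z y); have := miny z => h1 h2 h3.
have : mu / 16 * sqn (z - y) <= 0 by lra.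
rewrite pmulr_rle0; last lra.
move=> s0; apply/eqP; rewrite -subr_eq0; apply/eqP/sqn_eq0/eqP.
by rewrite eq_le s0 sqn_ge0.
Qed.

End Minimizer.

Lemma nonincreasing_limit {R : realType} (u : nat -> R) c :
  (forall k, u k.+1 <= u k) -> (forall k, c <= u k) ->
  exists l : R, [/\ c <= l, forall k, l <= u k &
    forall e : R, 0 < e -> exists K, forall k, (K <= k)%N -> u k <= l + e].
Proof.
move=> dec lb; pose E := range u.
have lbE : has_lbound E by exists c => _ [k _ <-].
have E0 : E !=set0 by exists (u 0%N), 0%N.
have mono j k : (j <= k)%N -> u k <= u j.
  move=> /subnK <-; elim: (k - j)%N => // n IH.
  by rewrite addSn; apply: le_trans IH.
exists (inf E); split; first by apply: lb_le_inf => // _ [k _ <-].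
  by move=> k; apply: ge_inf => //; exists k.
move=> e e0; have [_ [K _ <-] hK] := inf_adherent e0 (conj E0 lbE).
by exists K => k /mono hk; apply: le_trans hk (ltW hK).
Qed.

Section Run.
Context {R : realType}.
Variables (f : 'rV[R]_2 -> R) (T : nat -> triangle R) (z : 'rV[R]_2).
Hypothesis cf : classF f.
Hypothesis run : rnm_run f T.
Hypothesis minz : minimizer f z.

Lemma run_invariant k : ordered f (T k) /\ det2 (T k) != 0.
Proof.
have [nd0 ord0 st] := run; elim: k => [|k [ordk ndk]].
  by split => //; exact: nondegenerate_det2.
case: (rnm_step_kind ordk (accepted_classF cf ordk ndk) (st k)) => [hr|hc].
  have [e _] := reflects_shape hr; rewrite e; split => //.
  by case: hr => _ ->; exact: ordered_replace_worst.
have [e _] := contracts_shape hc; split.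
  by case: hc => q [_ _ _ _ ->]; exact: ordered_replace_worst.
by apply: contra ndk => /eqP e'; rewrite e e' mulr0.
Qed.

Lemma run_ordered k : ordered f (T k). Proof. by have [] := run_invariant k.
Qed.

Lemma run_accepted k : accepted f (T k).
Proof. by have [ordk ndk] := run_invariant k; exact: accepted_classF. Qed.

Lemma run_kind k : reflects f (T k) (T k.+1) \/ contracts f (T k) (T k.+1).
Proof.
by have [_ _ st] := run;
  exact: rnm_step_kind (run_ordered k) (run_accepted k) (st k).
Qed.

Let a k := f (p1 (T k)).
Let b k := f (p2 (T k)).
Let c k := f (p3 (T k)).

Lemma run_le k : a k <= b k /\ b k <= c k.
Proof. by have /andP[] := run_ordered k. Qed.

(** A reflected point beats the second value; a contracted one is at most (a +
    b) / 4 + c / 2. *)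
Lemma run_new_value k : exists2 q, T k.+1 = replace_worst f (T k) q &
  f q <= (b k + c k) / 2.
Proof.
have [C2f _ _] := cf; have [ab bc] := run_le k.
case: (run_kind k) => [[h E]|[q [hq bq qc _ E]]].
  by exists (reflection (T k)) => //; move: h; rewrite -/(b k); lra.
exists (contraction (T k) q) => //.
pose rho := Num.max `|p1 (T k)| (Num.max `|p2 (T k)| `|q|).
have rho0 : 0 <= rho by rewrite le_max normr_ge0.
have [mu [M [mu0 _ curved]]] := hessian_bounds rho0 cf.
have h1 : `|p1 (T k)| <= rho by rewrite le_max lexx.
have h2 : `|p2 (T k)| <= rho by rewrite !le_max lexx orbT.
have h3 : `|q| <= rho by rewrite !le_max lexx !orbT.
have := contraction_value C2f curved (ltW mu0) h1 h2 h3.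
have : 0 <= mu / 32 * (sqn (p1 (T k) - p2 (T k)) + sqn (p1 (T k) - q) + sqn (p2
  (T k) - q)).
  apply: mulr_ge0; first by rewrite divr_ge0// ltW.
  by apply: addr_ge0 (sqn_ge0 _); exact: addr_ge0 (sqn_ge0 _) (sqn_ge0 _).
move: bq qc ab bc; rewrite -/(a k) -/(b k) -/(c k); lra.
Qed.

Lemma run_decreasing k :
  [/\ a k.+1 <= a k, b k.+1 <= b k, c k.+1 <= (b k + c k) / 2 & c k.+1 <= c k].
Proof.
have [ab bc] := run_le k; have [q E hq] := run_new_value k.
have [_ h1 h2 _ h3] := replace_worst_values q ab.
have h4 : c k.+1 <= (b k + c k) / 2.
  by rewrite /c E h3 ge_max; apply/andP; split; move: bc hq; rewrite /b /c; lra.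
by rewrite /a /b E; split => //; apply: le_trans h4 _; lra.
Qed.

Lemma run_bounded : exists rho : R, 0 <= rho /\ forall k,
  [/\ `|p1 (T k)| <= rho, `|p2 (T k)| <= rho, `|p3 (T k)| <= rho &
      `|reflection (T k)| <= rho].
Proof.
have [_ bnd _] := cf; have [B [_ hB]] := bnd (c 0%N).
pose B' := Num.max 0 (B + 1).
have B'0 : 0 <= B' by rewrite le_max lexx.
have hB' x : f x <= c 0%N -> `|x| <= B'.
  by apply: hB; rewrite lt_max ltrDl ltr01 orbT.
have ck k : c k <= c 0%N.
  elim: k => [//|k IH]; have [_ _ _ h] := run_decreasing k.
  exact: le_trans IH.
exists (3 * B'); split; first by rewrite mulr_ge0.
move=> k; have [ab bc] := run_le k.
have h1 : `|p1 (T k)| <= B' by apply: hB';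
  apply: le_trans ab (le_trans bc (ck k)).
have h2 : `|p2 (T k)| <= B' by apply: hB'; apply: le_trans bc (ck k).
have h3 : `|p3 (T k)| <= B' by apply: hB'; apply: ck.
split; [lra|lra|lra|].
rewrite /reflection /midpoint scalerA divff// scale1r.
apply: le_trans (ler_normB _ _) _; have := ler_normD (p1 (T k)) (p2 (T k)); lra.
Qed.

(** The second and third values share their limit, because the third is at most
    the mean of the previous second and third. *)
Lemma run_limits : exists al be : R, [/\ f z <= al, al <= be,
  forall k, al <= a k /\ be <= b k &
  forall e : R, 0 < e -> exists K, forall k, (K <= k)%N ->
    a k <= al + e /\ c k <= be + e].
Proof.
have da k : a k.+1 <= a k by have [] := run_decreasing k.
have db k : b k.+1 <= b k by have [] := run_decreasing k.
have dc k : c k.+1 <= c k by have [] := run_decreasing k.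
have [al [zal ala alK]] := nonincreasing_limit da (fun k => minz (p1 (T k))).
have [be [_ beb beK]] := nonincreasing_limit db (fun k => minz (p2 (T k))).
have [ga [_ gac gaK]] := nonincreasing_limit dc (fun k => minz (p3 (T k))).
exists al, be; split => // [|e e0].
  rewrite leNgt; apply/negP => albe;
    have [K /(_ _ (leqnn K))] := beK ((al - be) / 2) ltac:(lra).
  by have [h _] := run_le K; have := ala K; lra.
have gabe : ga <= be.
  rewrite leNgt; apply/negP => bega; have e' : 0 < (ga - be) / 4 by lra.
  have [K1 h1] := beK _ e'; have [K2 h2] := gaK _ e'.
  have := h1 _ (leq_maxl K1 K2); have := h2 _ (leq_maxr K1 K2);
    set k := maxn K1 K2.
  by have [_ _ h _] := run_decreasing k; have := gac k.+1; lra.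
have [K1 h1] := alK _ e0; have [K2 h2] := gaK _ e0; exists (maxn K1 K2) => k.
by rewrite geq_max => /andP[/h1 ? /h2 ?]; split; lra.
Qed.

(** After a reflection the new worst vertex is always the old second one. *)
Lemma reflects_next k : reflects f (T k) (T k.+1) ->
  [/\ p3 (T k.+1) = p2 (T k),
      T k.+1 = Triangle (reflection (T k)) (p1 (T k)) (p2 (T k)) \/
      T k.+1 = Triangle (p1 (T k)) (reflection (T k)) (p2 (T k)) &
      b k.+1 < b k \/ b k.+1 = a k].
Proof.
move=> [h E]; have [ab _] := run_le k.
case: (replace_worstP (reflection (T k)) ab) => -[h']; rewrite -E => Ek.
- by split; rewrite ?Ek//; [left|right; rewrite /b Ek].
- by split; rewrite ?Ek//; [right|left; rewrite /b Ek].
- by move: h'; rewrite leNgt h.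
Qed.

(** Suppose that only reflections occur from [K] on, so that all triangles are
    congruent. Two successive reflections make [p1] the midpoint of [p3] and of
    a new vertex. If all values have the same limit, strong convexity forces
    the edge [p1 p3] to shrink to 0, against the constant area. Otherwise [p1]
    is eventually fixed, the reflections turn around it, and six of them give
    back the second vertex although its value has strictly decreased. *)
Lemma contracts_infinitely_often K : exists2 k,
  (K <= k)%N & contracts f (T k) (T k.+1).
Proof.
apply: contrapT => hno.
have refl k : (K <= k)%N -> reflects f (T k) (T k.+1).
  by move=> hk; case: (run_kind k) => // hc; exfalso; apply: hno; exists k.
have [al [be [_ + lb]]] := run_limits;
  rewrite le_eqVlt => /predU1P[albe|albe] lim.
  have [rho [rho0 hrho]] := run_bounded.
  have [mu [M [mu0 _ curved]]] := hessian_bounds rho0 cf.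
  have shape k : (K <= k)%N ->
    det2 (T k) = det2 (T K) /\ diam2 (T k) = diam2 (T K).
    move=> /subnK <-; elim: (k - K)%N => // n [IH1 IH2].
    by have [-> ->] := reflects_shape (refl (n + K)%N (leq_addl _ _)).
  set d := det2 (T K) in shape; set D := diam2 (T K) in shape.
  have d0 : 0 < d by rewrite lt_neqAle eq_sym det2_ge0 andbT;
    have [] := run_invariant K.
  have D0 : 0 <= D by exact: diam2_ge0.
  (* The tolerance that makes det2 <= sqn (p1 - p3) * diam2 absurd. *)
  have e0 : 0 < mu * d / (8 * (D + 1)) by apply: divr_gt0;
    apply: mulr_gt0 => //; exact: ltr_wpDl.
  have [K1 hK1] := lim _ e0; have := hK1 _ (leq_maxl K1 K).
  have hk := leq_maxr K1 K; move: (maxn K1 K) hk => k hk [_ ck].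
  have [ak _] := lb k; have [dk Dk] := shape k hk.
  have [_ T1 _] := reflects_next (refl k hk).
  have [h2 _] := refl k.+1 (leqW hk).
  have [hr3 hr] : `|p3 (T k)| <= rho /\ `|reflection (T k.+1)| <= rho.
    by have [_ _ ? _] := hrho k; have [_ _ _ ?] := hrho k.+1.
  have := midpoint_value cf curved (ltW mu0) hr3 hr.
  have -> : reflection (T k.+1) = 2 *: p1 (T k) - p3 (T k).
    by case: T1 => ->; apply: row2_ext; rewrite /reflection /midpoint /= !mxE;
      field.
  have -> : midpoint (p3 (T k)) (2 *: p1 (T k) - p3 (T k)) = p1 (T k).
    by apply: row2_ext; rewrite /midpoint !mxE; field.
  have -> : sqn (p3 (T k) - (2 *: p1 (T k) - p3 (T k))) = 4 * sqn (p1 (T k) -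
    p3 (T k)).
    by rewrite /sqn !mxE; ring.
  have hb : f (reflection (T k.+1)) < b k.
    by apply: lt_le_trans h2 _; have [_ h _ _] := run_decreasing k.
  move: hb; have -> : reflection (T k.+1) = 2 *: p1 (T k) - p3 (T k).
    by case: T1 => ->; apply: row2_ext; rewrite /reflection /midpoint /= !mxE;
      field.
  have [_ bc] := run_le k; have := det2_le_edge (T k); rewrite dk Dk.
  move: ak bc ck; rewrite -albe -/(a k) -/(c k).
  have := sqn_ge0 (p1 (T k) - p3 (T k)).
  move: (sqn _) (f (2 *: _ - _)) (a k) (b k) (c k) => s fr ak bk ck s0 h3 h4 h5
    h6 h7 h8.
  have h9 : mu * s <= 4 * (mu * d / (8 * (D + 1))) by lra.
  have D1 : 0 < D + 1 by exact: ltr_wpDl.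
  have h10 : mu * s * D <= 4 * (mu * d / (8 * (D + 1))) * (D + 1).
    apply: (@le_trans _ _ (4 * (mu * d / (8 * (D + 1))) * D));
      first by rewrite ler_wpM2r.
    by apply: ler_wpM2l; [rewrite mulr_ge0// ltW|rewrite lerDl].
  move: h10; have -> : 4 * (mu * d / (8 * (D + 1))) * (D + 1) = mu * (d / 2).
    by field; rewrite gt_eqF.
  by rewrite -mulrA ler_pM2l// => h10; lra.
have [K1 hK1] := lim ((be - al) / 2) ltac:(lra).
have stay k : (maxn K K1 <= k)%N ->
    [/\ p1 (T k.+1) = p1 (T k), p2 (T k.+1) = reflection (T k),
        p3 (T k.+1) = p2 (T k) & b k.+1 < b k].
  rewrite geq_max => /andP[hk /hK1[ak _]].
  have [E3 E12 hb] := reflects_next (refl k hk).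
  have [_ bk] := lb k.+1; have [_ bk'] := lb k.
  case: hb => [hb|hb]; last by exfalso; move: bk; rewrite hb; lra.
  case: E12 => Ek; last by split => //; rewrite Ek.
  by exfalso; move: bk; rewrite /b Ek /= -/(a k); lra.
have ent k i : (maxn K K1 <= k)%N ->
    [/\ p1 (T k.+1) 0 i = p1 (T k) 0 i,
        p2 (T k.+1) 0 i = p1 (T k) 0 i + p2 (T k) 0 i - p3 (T k) 0 i &
        p3 (T k.+1) 0 i = p2 (T k) 0 i].
  move=> /stay[-> -> -> _]; split => //.
  by rewrite /reflection /midpoint !mxE; field.
move: (maxn K K1) stay ent => k stay ent.
(* Reflecting around p1 is a linear map of order 6 on (p2 - p1, p3 - p1). *)
have per i : p2 (T k.+1.+1.+1.+1.+1.+1) 0 i = p2 (T k) 0 i.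
  have [a0 b0 c0] := ent k i (leqnn _).
  have [a1 b1 c1] := ent k.+1 i ltac:(exact: leqW).
  have [a2 b2 c2] := ent k.+2 i ltac:(by do 2 apply: leqW).
  have [a3 b3 c3] := ent k.+3 i ltac:(by do 3 apply: leqW).
  have [a4 b4 c4] := ent k.+4 i ltac:(by do 4 apply: leqW).
  have [a5 b5 c5] := ent k.+4.+1 i ltac:(by do 5 apply: leqW).
  by rewrite b5 a4 b4 c4 a3 b3 c3 a2 b2 c2 a1 b1 c1 a0 b0 c0; ring.
have bper : b k.+4.+2 = b k by congr f; apply: row2_ext; apply: per.
have [_ _ _ s0] := stay k (leqnn _).
have dec j : b j.+1 <= b j by have [] := run_decreasing j.
have := dec k.+1; have := dec k.+2; have := dec k.+3; have := dec k.+4;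
  have := dec k.+4.+1.
by rewrite bper; lra.
Qed.

(** At a contraction the new value is at most (a + b) / 4 + c / 2 minus a
    multiple of the squared diameter. If the first value had a smaller limit
    than the others, this would eventually fall below the limit of the second
    value. When the limits agree, the same inequality makes the diameter small,
    and the diameter never increases. *)
Lemma run_common_limit : exists al : R, [/\ f z <= al, forall k, al <= a k &
  forall e : R, 0 < e -> exists K, forall k, (K <= k)%N ->
    c k <= al + e /\ diam2 (T k) <= e].
Proof.
have [al [be [zal albe lb lim]]] := run_limits; exists al; split => //.
  by move=> k; have [] := lb k.
have [C2f _ _] := cf; have [rho [rho0 hrho]] := run_bounded.
have [mu [M [mu0 _ curved]]] := hessian_bounds rho0 cf.
have ctr k : contracts f (T k) (T k.+1) ->
  exists2 q, T k.+1 = replace_worst f (T k) q &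
    f q + mu / 32 * diam2 (T k) <= (a k + b k) / 4 + c k / 2.
  case=> q [hq _ qc _ E]; exists (contraction (T k) q) => //.
  have [n1 n2 n3 nr] := hrho k; have nq : `|q| <= rho by case: hq => ->.
  have := contraction_value C2f curved (ltW mu0) n1 n2 nq.
  rewrite -/(a k) -/(b k).
  have D : diam2 (T k) <= sqn (p1 (T k) - p2 (T k)) + sqn (p1 (T k) - q) + sqn
    (p2 (T k) - q).
    have -> : diam2 (T k) = diam2 (Triangle (p1 (T k)) (p2 (T k)) q).
      by case: hq => -> //; rewrite diam2_reflected.
    have := sqn_ge0 (p1 (T k) - p2 (T k)); have := sqn_ge0 (p1 (T k) - q).
    have := sqn_ge0 (p2 (T k) - q).
    by rewrite diam2_le /= => s1 s2 s3; apply/and3P; split; lra.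
  have mu32 : 0 <= mu / 32 by lra.
  have := ler_wpM2l mu32 D; move: qc; rewrite -/(c k); lra.
have diam_mono j k : (j <= k)%N -> diam2 (T k) <= diam2 (T j).
  move=> /subnK <-; elim: (k - j)%N => // n IH; apply: le_trans IH.
  case: (run_kind (n + j)) => [/reflects_shape[_ /=]|/contracts_shape[_]//].
  by rewrite addSn => ->.
have beal : be <= al.
  rewrite leNgt; apply/negP => albe'; have e0 : 0 < (be - al) / 8 by lra.
  have [K hK] := lim _ e0;
    have [k /hK[ak ck] hc] := contracts_infinitely_often K.
  have [q E hq] := ctr k hc; have [ab bc] := run_le k.
  have [_ _ _ + _] := replace_worst_values q ab; rewrite -E -/(b k.+1) le_max.
  have [_ bk] := lb k.+1; have [_ bk'] := lb k.
  have d0 : 0 <= mu / 32 * diam2 (T k) by rewrite mulr_ge0 ?diam2_ge0//; lra.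
  by rewrite -/(a k); case/orP => h; lra.
move=> e e0; pose e1 := Num.min e (mu / 32 * e).
have e10 : 0 < e1 by rewrite lt_min e0 mulr_gt0//; lra.
have [K hK] := lim _ e10; have [k0 hk0 hc] := contracts_infinitely_often K.
have [e1e e1mu] : e1 <= e /\ e1 <= mu / 32 * e by rewrite !ge_min !lexx orbT.
exists k0 => k hk; have [_ ck] := hK k (leq_trans hk0 hk); split; first by lra.
apply: le_trans (diam_mono _ _ hk) _.
have [q E hq] := ctr k0 hc; have [_ c0] := hK k0 hk0; have [ab bc] := run_le k0.
have [ak1 _] := lb k0.+1; have [h _ _ _ _] := replace_worst_values q ab.
rewrite -(@ler_pM2l _ (mu / 32)); last by lra.
by move: h; rewrite -E -/(a k0.+1); lra.
Qed.

End Run.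

(** * A checker for case trees in the model y + x^2 *)

Section Checker.
Local Open Scope Z_scope.

Definition affine_form := (Z * Z)%type.

(** The form c1 + cm m + cs m^2 + ca a + cb b in the parameters of the model.
    *)
Record qform := QForm { c1 : Z; cm : Z; cs : Z; ca : Z; cb : Z }.

(** The x coordinate, affine in [m], and the value of y + x^2, both multiplied
    by powers of 4 and 16 that clear denominators after [k] contractions. *)
Definition spoint := (affine_form * qform)%type.

Definition add_form g h := QForm (c1 g + c1 h) (cm g + cm h) (cs g + cs h)
  (ca g + ca h) (cb g + cb h).

Definition scale_form (n : Z) g :=
  QForm (n * c1 g) (n * cm g) (n * cs g) (n * ca g) (n * cb g).

Definition square_form (x : affine_form) :=
  QForm (x.1 * x.1) (2 * (x.1 * x.2)) (x.2 * x.2) 0 0.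

Definition comb_affine (w1 w2 w3 : Z) (x1 x2 x3 : affine_form) : affine_form :=
  (w1 * x1.1 + w2 * x2.1 + w3 * x3.1, w1 * x1.2 + w2 * x2.2 + w3 * x3.2).

Definition comb_form (w1 w2 w3 : Z) g1 g2 g3 :=
  add_form (scale_form w1 g1) (add_form (scale_form w2 g2) (scale_form w3 g3)).

(** The point with barycentric weights [w / d]: y is affine, hence the value is
    obtained by averaging [F - x^2] and adding the square of the new x. The
    result is in units refined by the factor [d]. *)
Definition comb (w1 w2 w3 : Z) (P1 P2 P3 : spoint) : spoint :=
  let d := (w1 + w2 + w3) in
  let x := comb_affine w1 w2 w3 P1.1 P2.1 P3.1 in
  (x, add_form (square_form x)
    (comb_form (d * w1) (d * w2) (d * w3)
      (add_form P1.2 (scale_form (-1) (square_form P1.1)))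
      (add_form P2.2 (scale_form (-1) (square_form P2.1)))
      (add_form P3.2 (scale_form (-1) (square_form P3.1))))).

Definition rescale (P : spoint) : spoint :=
  ((4 * P.1.1, 4 * P.1.2), scale_form 16 P.2).

(** The form to be nonpositive when the value [g] was observed to be at most
    [h], with tolerance 1 / 10000 in the unscaled values. *)
Definition le_form (k : nat) (g h : qform) : qform :=
  add_form (QForm (- Z.pow 16 (Z.of_nat k)) 0 0 0 0)
    (scale_form 10000 (add_form g (scale_form (-1) h))).

Definition zero_form := QForm 0 0 0 0 0.

Fixpoint weighted_sum (l : seq (Z * Z)) (C : seq qform) : qform :=
  if l is (i, w) :: l' then
    add_form (scale_form (Z.max 0 w) (nth zero_form C (Z.to_nat i)))
      (weighted_sum l' C)
  else zero_form.

(** A Farkas certificate: a nonnegative combination of the constraints whose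
    constant term exceeds its variable part, given that m, m^2, a and b are at
    most 2 in absolute value. Rounded multipliers are thus admissible. *)
Definition refute (l : seq (Z * Z)) (C : seq qform) : bool :=
  let g := weighted_sum l C in
  Z.ltb (2 * (Z.abs (cm g) + Z.abs (cs g) + Z.abs (ca g) + Z.abs (cb g))) (c1
    g).

(** An affine function of [m] is bounded on [79/100, 101/100] by its values at
    the ends. *)
Definition gap (x y : affine_form) : Z :=
  Z.max (Z.abs (100 * (x.1 - y.1) + 79 * (x.2 - y.2)))
    (Z.abs (100 * (x.1 - y.1) + 101 * (x.2 - y.2))).

Definition width (P1 P2 P3 : spoint) : Z :=
  Z.max (gap P1.1 P2.1) (Z.max (gap P1.1 P3.1) (gap P2.1 P3.1)).

(** After [k] contractions det2 is divided by 4^k, so that the growth of det2 /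
    W^6 is the square of (101/100) 2^k (W + 1/20000)^3 <= 1. Here [W] is the
    largest width over the range of [m], the initial width being at least 1. *)
Definition narrow (k : nat) (P1 P2 P3 : spoint) : bool :=
  let u := Z.pow 4 (Z.of_nat k) in
  Z.leb (101 * 2 ^ Z.of_nat k * (200 * width P1 P2 P3 + u) ^ 3)
    (100 * (20000 * u) ^ 3).

(** Nodes are used alternately for the three moves (reflection, inside and
    outside contraction) and for the three ranks that the new vertex may take.
    *)
Inductive tree :=
  | Done
  | Cut of seq (Z * Z)
  | Node of tree & tree & tree.

Fixpoint height t :=
  if t is Node a b c then (maxn (height a) (maxn (height b) (height c))).+1
  else 0%nat.

(** [new] is [None] when the three points form the current triangle, and [Some
    r] when [P3] is a point waiting for its rank, [r] telling whether it comes
    from a reflection, in which case it cannot be ranked last. *)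
Fixpoint check (t : tree) (k : nat) (P1 P2 P3 : spoint) (new : option bool)
    (C : seq qform) {struct t} : bool :=
  match t, new with
  | Cut l, _ => refute l C
  | Done, None => narrow k P1 P2 P3
  | Done, Some _ => false
  | Node r i o, None =>
      let Q := comb 1 1 (-1) P1 P2 P3 in
      let P1' := rescale P1 in let P2' := rescale P2 in
      [&& check r k P1 P2 Q (Some true) (le_form k Q.2 P2.2 :: C),
          check i k.+1 P1' P2' (comb 1 1 2 P1 P2 P3) (Some false)
            (le_form k P3.2 Q.2 :: C)
        & check o k.+1 P1' P2' (comb 1 1 2 P1 P2 Q) (Some false)
            (le_form k P2.2 Q.2 :: le_form k Q.2 P3.2 :: C)]
  | Node a b c, Some refl =>
      [&& check a k P3 P1 P2 None (le_form k P3.2 P1.2 :: C),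
          check b k P1 P3 P2 None
            (le_form k P1.2 P3.2 :: le_form k P3.2 P2.2 :: C)
        & refl || check c k P1 P2 P3 None (le_form k P2.2 P3.2 :: C)]
  end.

(** Linear consequences of the range of [m] for the pair (m, m^2): the parabola
    is below its chord and above its tangents. *)
Definition chord (lo hi : Z) : qform :=
  QForm (lo * hi) (- ((lo + hi) * 100)) (100 * 100) 0 0.

Definition tangent (c : Z) : qform :=
  QForm (- (c * c)) (2 * c * 100) (- (100 * 100)) 0 0.

Definition range_constraints : seq qform :=
  [:: QForm 79 (-100) 0 0 0; QForm (-101) 100 0 0 0;
      chord 79 101; tangent 79; tangent 90; tangent 101].

Definition root_constraints (A B Q : spoint) : seq qform :=
  [:: le_form 0 Q.2 (comb 1 1 (-1) A B Q).2, le_form 0 A.2 B.2,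
      le_form 0 B.2 Q.2 & range_constraints].

Definition root_check (t : tree) (A B Q : spoint) : bool :=
  check t 1 (rescale A) (rescale B) (comb 1 1 2 A B Q) (Some false)
    (root_constraints A B Q).

Definition ptL : spoint := ((0, 0), zero_form).
Definition ptM : spoint := ((0, 1), QForm 0 0 0 1 0).
Definition ptQ : spoint := ((1, 0), QForm 0 0 0 0 1).

End Checker.

(** * The case tree *)

Section Cert.
Local Open Scope Z_scope.
Local Notation N := Node.
Local Notation C := Cut.
Local Notation D := Done.
(** The multipliers were found by linear programming and rounded. The long
    branches are sequences of outside contractions that create new best
    vertices; along them the ratio first decreases. *)
Definition tree_LM : tree :=
  N (N (N (N (N (N (N (C [:: (6, 82); (0, 61); (10, 262144); (13, 2692); (9,
  653)]) (N (N (N (C [:: (13, 32); (19, 2); (8, 1); (0, 4); (12, 28)]) (N D D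
  D) (C [:: (14, 128); (10, 6); (5, 1); (1, 9); (9, 14)])) (C [:: (0, 41); (4,
  27); (9, 14); (14, 65536)]) D) (C [:: (8, 10); (2, 3); (12, 32768); (7, 7);
  (0, 10)]) (C [:: (16, 112); (0, 9); (13, 32768); (9, 9)])) D) (N (N (C [::
  (10, 34); (5, 9); (11, 16384); (0, 1); (9, 40)]) (N D D D) (C [:: (2, 6);
  (6, 111); (11, 198); (1, 5); (12, 65536)])) (N (C [:: (11, 109); (6, 3);
  (12, 4096); (0, 1); (10, 123)]) (N D D D) (C [:: (12, 2048); (16, 84); (7,
  191); (1, 13); (11, 1659)])) (C [:: (0, 3); (7, 3); (6, 23); (1, 12); (10,
  32768)])) (N (N (C [:: (11, 4096); (8, 1593); (0, 159); (2, 2287); (1,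
  175)]) (C [:: (0, 23); (9, 689); (7, 99); (8, 377); (12, 1048576)]) (N (N (C
  [:: (0, 89); (18, 32927); (15, 2097152); (11, 1428); (5, 8566)]) (N (N (C
  [:: (16, 58108); (17, 4194304); (19, 26324); (11, 13138); (0, 7)]) (N D D D)
  (C [:: (17, 131072); (2, 10); (12, 21238); (7, 1994); (1, 11)])) (C [:: (19,
  2097152); (13, 391692); (0, 319); (7, 587856); (6, 47956)]) (C [:: (16,
  16777216); (0, 7); (13, 11587); (12, 5496); (1, 43)])) (C [:: (1, 1); (19,
  705); (16, 262144); (12, 208); (6, 224)])) (C [:: (15, 16777216); (0, 43);
  (18, 57469); (11, 7577); (5, 1378)]) (C [:: (10, 813); (5, 1344); (14,
  4194304); (9, 498); (0, 33)]))) (N (N (C [:: (5, 219); (8, 2201); (0, 2474);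
  (17, 524288); (13, 239256)]) (N (C [:: (0, 1); (18, 37); (16, 16384); (10,
  12); (15, 36)]) (N D D D) (C [:: (11, 19); (1, 1); (15, 19); (16, 128)])) D)
  (C [:: (9, 377); (8, 99); (13, 1048576); (10, 689); (0, 23)]) (N (N (C [::
  (10, 11); (16, 262144); (0, 1); (14, 400); (2, 10)]) (N D D D) (C [:: (3,
  8); (19, 1518); (1, 3); (11, 881); (16, 4096)])) (C [:: (12, 813); (7,
  1344); (16, 4194304); (11, 498); (0, 33)]) (C [:: (11, 819); (0, 17); (15,
  4194304); (12, 4511); (3, 140)]))) (C [:: (0, 12); (7, 92); (2, 45); (11,
  131072); (6, 4)]))) (C [:: (5, 9); (0, 9); (9, 16384); (12, 56)]) D) (C [::
  (7, 65536); (4, 109); (3, 27); (2, 27); (0, 41)]) (C [:: (3, 14); (2, 14);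
  (8, 65536); (5, 109); (0, 41)])) (N (N (N (C [:: (0, 1); (12, 1); (10,
  1024); (8, 12); (9, 8)]) (N D D D) (C [:: (10, 67); (5, 3); (13, 56); (1,
  5); (9, 128)])) (C [:: (0, 24); (7, 27); (4, 17); (10, 32768); (8, 55)]) D)
  (C [:: (8, 65536); (5, 109); (4, 27); (2, 27); (0, 41)]) (C [:: (5, 14); (0,
  41); (9, 65536); (6, 109); (2, 14)])) D) (N (N (C [:: (7, 32768); (1, 1);
  (5, 302); (0, 2)]) (N D D D) (C [:: (1, 7); (10, 427); (8, 65536); (6,
  2280); (2, 11)])) (N (C [:: (0, 3); (8, 65536); (3, 3); (6, 592); (7, 328)])
  (N D D D) (C [:: (8, 1105); (11, 269); (9, 131072); (1, 7); (7, 2541)])) (C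
  [:: (1, 45); (3, 315); (8, 512); (0, 7); (5, 47)])) (N (N (C [:: (7, 4096);
  (11, 2894); (0, 49); (2, 57); (1, 6)]) (N (N (C [:: (6, 255); (8, 688); (0,
  1); (10, 262144); (4, 82)]) (N D D D) (C [:: (7, 1938); (8, 97); (1, 5);
  (11, 1048576); (5, 860)])) (N (C [:: (7, 183); (8, 195); (0, 1); (11,
  262144); (5, 162)]) (N D D D) (C [:: (8, 1938); (1, 5); (6, 860); (12,
  1048576); (9, 97)])) (C [:: (0, 4); (4, 176); (11, 207); (9, 262144); (1,
  27)])) (N (N (C [:: (1, 9); (0, 89); (5, 7719); (14, 32768); (10, 5854)]) (N
  (N (C [:: (0, 1); (11, 6497); (6, 120); (13, 2097152)]) (N D D D) (C [:: (1,
  5); (12, 11736); (7, 1624); (14, 8388608); (2, 9)])) (C [:: (0, 161); (6,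
  4994); (7, 44641); (16, 701888); (12, 1048576)]) (C [:: (4, 475); (12,
  2097152); (14, 23073); (1, 74); (0, 11)])) (N (N (C [:: (8, 39879); (17,
  1048576); (0, 158); (1, 27); (13, 986796)]) (N (N (C [:: (6, 642); (14,
  260532); (0, 3); (16, 67108864); (10, 22471)]) (N (N (N (C [:: (11, 3082);
  (14, 163512); (21, 2097152); (0, 3); (8, 515)]) (N (C [:: (0, 5); (7, 285);
  (14, 14042); (19, 1344315); (21, 536870912)]) (N D D D) (C [:: (1, 29); (17,
  1068117); (11, 20400); (22, 4294967296); (8, 3053)])) D) (N D D D) (N D D
  D)) (C [:: (8, 69217); (10, 58288); (18, 2147483648); (21, 6859218); (0,
  57)]) (C [:: (20, 16777216); (7, 78884); (16, 5270747); (11, 5388433); (0,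
  45)])) (C [:: (7, 4437); (15, 748203); (17, 134217728); (11, 200690); (1,
  11)])) (C [:: (6, 1520); (0, 53); (10, 354605); (19, 2097152); (15,
  1189763)]) (C [:: (0, 6); (10, 6016); (4, 199); (15, 33554432); (1, 41)]))
  (N (N (C [:: (3, 30); (0, 21); (11, 185532); (20, 1048576); (16, 264466)])
  (N (N (C [:: (0, 5); (12, 134030); (18, 1091954); (19, 1073741824); (1, 3)])
  (N (N (N (C [:: (11, 2680); (22, 134217728); (24, 1045943); (8, 586); (0,
  1)]) (N (C [:: (10, 2627); (22, 34277317); (0, 17); (24, 17179869184); (7,
  1066)]) (N D D D) (C [:: (11, 19436); (23, 9164195); (25, 17179869184); (8,
  1849); (1, 19)])) D) (N D D D) (N D D D)) (C [:: (8, 98265); (10, 82750);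
  (23, 41035436); (0, 81); (21, 8589934592)]) (C [:: (19, 251729417); (23,
  268435456); (7, 68817); (0, 37); (14, 20948870)])) (C [:: (1, 3); (19,
  5907739); (20, 134217728); (13, 197782); (2, 2)])) (C [:: (22, 16777216);
  (6, 957); (0, 28); (13, 972267); (18, 14439058)]) (C [:: (4, 296); (16,
  136759); (18, 268435456); (1, 47); (0, 7)])) (N (N (C [:: (23, 16777216);
  (1, 11); (0, 68); (14, 1955040); (11, 376297)]) (N (N (C [:: (8, 8918); (20,
  46567310); (0, 5); (22, 8589934592); (16, 12922270)]) (N (N (N (C [:: (11,
  17455); (25, 34359738368); (27, 1730757541); (0, 51); (14, 3909870)]) (N (C
  [:: (0, 3); (7, 178); (20, 1281897); (25, 63110878); (27, 34359738368)]) (N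
  D D D) (C [:: (8, 609); (17, 511191); (11, 676); (1, 5); (28,
  68719476736)])) D) (C [:: (10, 83359209); (0, 3669); (18, 110957200256);
  (27, 1099511627776); (23, 683153680908)]) (N (C [:: (15, 30943189); (26,
  274877906944); (28, 15649080170); (12, 3005462); (0, 77)]) (N (C [:: (8,
  4243); (3, 11); (0, 5); (26, 1723307696); (28, 549755813888)]) (N D D D) (C
  [:: (9, 32776); (4, 356); (1, 31); (27, 5989185793); (29, 2199023255552)]))
  (C [:: (12, 798334); (0, 10); (20, 536870912); (29, 26875248); (2, 49)])))
  (C [:: (10, 382175); (0, 31); (18, 323449626); (27, 1073741824); (23,
  491618646)]) (C [:: (9, 17347); (0, 1); (17, 24095164); (26, 134217728);
  (22, 63190540)])) (C [:: (1, 3); (21, 16408774); (9, 11197); (26, 11395658);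
  (17, 16777216)])) (C [:: (8, 3260); (0, 11); (16, 9140693); (25, 67108864);
  (21, 31904573)]) (C [:: (1, 116); (19, 28204526); (4, 664); (0, 17); (21,
  8589934592)])) (N (N (C [:: (0, 15); (26, 67108864); (17, 12902506); (3,
  24); (22, 12662908)]) (N (N (C [:: (0, 1); (18, 5590797); (24, 154725801);
  (25, 17179869184)]) (N (N (N (C [:: (14, 364861); (23, 12055781); (28,
  274877906944); (26, 385176430); (0, 5)]) (N (C [:: (0, 17); (28,
  4294967296); (24, 3059602363); (10, 16358); (33, 1748749484)]) (N D D D) (C
  [:: (1, 25); (34, 8589934592); (25, 4645155104); (11, 46710); (8, 717)])) D)
  (C [:: (0, 39); (10, 928485); (21, 8541628627); (30, 137438953472); (26,
  99519143919)]) (N (C [:: (15, 1264828); (9, 208773); (31, 68719476736); (0,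
  69); (12, 3553491)]) (N (C [:: (0, 9); (11, 4752); (3, 99); (29,
  34359738368); (25, 15165224723)]) (N D D D) (C [:: (1, 9); (26,
  13150676472); (4, 179); (35, 34359738368); (9, 1896)])) (C [:: (28,
  2151111281); (0, 165); (23, 68719476736); (2, 859); (12, 12677130)]))) (C
  [:: (10, 746008); (30, 34359738368); (21, 4167483732); (0, 57); (26,
  27811117332)]) (C [:: (9, 352937); (29, 34359738368); (20, 3154744895); (0,
  19); (25, 25530712676)])) (C [:: (20, 269212439); (7, 6834); (26,
  274877906944); (1, 17); (24, 1089967712)])) (C [:: (0, 5); (6, 175); (19,
  20820229); (28, 268435456); (24, 183031607)]) (C [:: (0, 19); (27,
  268435456); (18, 142668036); (4, 1459); (1, 75)])) (N (N (C [:: (0, 48); (1,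
  9); (20, 213228863); (29, 1073741824); (17, 15361358)]) (N (N (C [:: (0, 9);
  (26, 12395499174); (28, 2199023255552); (8, 16502); (22, 2337826889)]) (N (N
  (N (C [:: (20, 51359246); (31, 8796093022208); (33, 50786751412); (0, 37);
  (14, 2357309)]) (N (C [:: (7, 1468); (31, 113051063356); (10, 1317); (0,
  23); (33, 35184372088832)]) (N D D D) (C [:: (8, 4741); (32, 243435949867);
  (11, 42234); (1, 47); (34, 70368744177664)])) D) (C [:: (0, 145); (33,
  4398046511104); (24, 419116115391); (10, 3356063); (29, 2277969638923)]) (N
  (C [:: (15, 4329024); (21, 289144892); (34, 274877906944); (12, 596713); (0,
  17)]) (N (C [:: (0, 5); (3, 10); (34, 70368744177664); (32, 221651332723);
  (8, 4568)]) (N D D D) (C [:: (1, 87); (38, 2199023255552); (4, 1708); (29,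
  1120820524040); (9, 24690)])) (C [:: (0, 59); (35, 8796093022208); (26,
  1173381392727); (12, 11389757); (31, 4022906579855)]))) (C [:: (0, 35); (33,
  137438953472); (24, 37358569899); (10, 446796); (29, 22935698861)]) (C [::
  (0, 21); (32, 274877906944); (23, 50326958103); (9, 374154); (28,
  86199015492)])) (C [:: (1, 25); (27, 34359738368); (29, 10653639164); (9,
  97746); (23, 14008971945)])) (C [:: (0, 15); (31, 8589934592); (22,
  1245805626); (8, 4730); (27, 3234247176)]) (C [:: (0, 75); (25,
  14544241001); (4, 2870); (27, 4398046511104); (1, 516)])) (C [:: (26,
  174026915127); (1, 1251); (21, 15898016626); (30, 274877906944); (4,
  16941)])) (C [:: (25, 5236005877); (3, 1497); (20, 837300887); (0, 151);
  (29, 8589934592)]) (C [:: (0, 3); (23, 32819462); (11, 13378); (5, 2); (25,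
  17179869184)]))) (C [:: (0, 101); (26, 536870912); (17, 68201238); (3, 976);
  (22, 252423164)]) (C [:: (11, 11803); (17, 257147); (24, 6919450); (0, 3);
  (22, 1073741824)]))) (C [:: (19, 13018806); (3, 257); (0, 26); (23,
  16777216); (14, 1269948)]) (C [:: (5, 290); (14, 172960); (21, 3829888);
  (19, 67108864); (0, 9)]))) (C [:: (3, 1658); (0, 173); (11, 1214706); (20,
  8388608); (16, 5396748)]) (C [:: (2, 1); (11, 23958); (18, 318351); (16,
  8388608); (0, 5)]))) (C [:: (17, 1588467); (3, 3167); (0, 323); (8, 140365);
  (13, 2097152)]) (C [:: (2, 1); (8, 1055); (15, 32768); (5, 274); (0, 7)])))
  (N (C [:: (4, 887); (0, 87); (6, 15178); (16, 28767); (11, 32768)]) (C [::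
  (4, 173); (12, 1048576); (14, 824); (0, 11); (1, 33)]) (N (N (C [:: (7, 11);
  (0, 1); (15, 2097152); (13, 4000); (2, 11)]) (N D D D) (C [:: (3, 124); (1,
  7); (16, 16777216); (8, 535); (14, 5250)])) (C [:: (3, 1); (10, 1055); (17,
  32768); (7, 274); (0, 7)]) (C [:: (6, 846); (14, 4194304); (16, 28728); (0,
  13); (3, 264)]))) (C [:: (2, 5); (5, 176); (12, 207); (10, 262144); (0,
  4)]))) (N (C [:: (12, 7054); (4, 1966); (8, 65536); (0, 389); (7, 35378)])
  (C [:: (6, 906); (4, 358); (11, 4096); (1, 72); (0, 31)]) (N (N (C [:: (0,
  1); (2, 9); (12, 262144); (10, 965); (6, 23)]) (N D D D) (C [:: (1, 7); (8,
  408); (3, 116); (13, 2097152); (11, 4704)])) (C [:: (3, 5); (7, 176); (14,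
  207); (12, 262144); (0, 4)]) (C [:: (3, 15); (6, 37); (2, 2); (11, 65536);
  (0, 1)]))) (C [:: (4, 315); (2, 10); (9, 512); (0, 7); (6, 47)]))) (N (N (N
  (C [:: (5, 16); (0, 1); (7, 32); (8, 8192); (11, 32)]) (N D D D) (C [:: (6,
  86); (9, 32768); (8, 147); (12, 107); (1, 3)])) (N (C [:: (6, 7); (11, 9);
  (0, 1); (1, 1); (9, 2048)]) (N D D D) (C [:: (7, 48); (12, 84); (1, 3); (2,
  9); (10, 4096)])) D) (C [:: (3, 16); (8, 12); (0, 1); (6, 1024); (1, 3)]) (N
  (N (C [:: (6, 52); (11, 49); (2, 33); (9, 65536); (0, 3)]) (N D D D) (C [::
  (7, 392); (12, 779); (1, 5); (3, 88); (10, 65536)])) (C [:: (6, 332); (11,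
  512); (3, 3); (4, 16); (0, 6)]) (C [:: (5, 332); (10, 512); (0, 6); (2, 3);
  (3, 109)]))) (C [:: (1, 75); (0, 19); (7, 56); (4, 16384); (2, 150)]).

Definition tree_ML : tree :=
  N (N (C [:: (0, 3); (5, 8192); (8, 12); (1, 1); (4, 32)]) (N D D D) (C [::
  (1, 3); (6, 8192); (2, 5); (5, 66)])) (N (C [:: (3, 43); (0, 3); (9, 22);
  (6, 16384); (5, 86)]) (N D D D) (C [:: (1, 5); (7, 32768); (10, 24); (4,
  97); (6, 232)])) (C [:: (1, 75); (0, 19); (2, 150); (4, 16384); (7, 56)]).
End Cert.
Lemma root_LM : root_check tree_LM ptL ptM ptQ.
Proof. by vm_compute. Qed.
Lemma root_ML : root_check tree_ML ptM ptL ptQ.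
Proof. by lazy. Qed.

(** * Real semantics of the checker *)

Delimit Scope Z_scope with ZZ.
Arguments Z.add : simpl never.
Arguments Z.mul : simpl never.
Arguments Z.sub : simpl never.
Arguments Z.opp : simpl never.
Arguments Z.max : simpl never.
Arguments Z.pow : simpl never.

Section Evaluation.
Context {R : realType}.

Definition zr (n : Z) : R := (int_of_Z n)%:~R.
Arguments zr n%_ZZ.

Lemma zrD m n : zr (m + n)%ZZ = zr m + zr n.
Proof. by rewrite /zr -rmorphD -rmorphD. Qed.

Lemma zrM m n : zr (m * n)%ZZ = zr m * zr n.
Proof. by rewrite /zr -rmorphM -rmorphM. Qed.

Lemma zrN m : zr (- m)%ZZ = - zr m.
Proof. by rewrite /zr -rmorphN -rmorphN. Qed.

Lemma zrB m n : zr (m - n)%ZZ = zr m - zr n.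
Proof. by rewrite /zr -rmorphB -rmorphB. Qed.

Lemma zrX m k : zr (m ^ Z.of_nat k)%ZZ = zr m ^+ k.
Proof.
elim: k => // k IH.
by rewrite Nat2Z.inj_succ Z.pow_succ_r ?zrM ?IH ?exprS//; exact: Zle_0_nat.
Qed.

Lemma zr_le m n : (m <= n)%ZZ -> zr m <= zr n.
Proof. by move=> mn; rewrite /zr ler_int; lia. Qed.

Lemma zr_lt m n : (m < n)%ZZ -> zr m < zr n.
Proof. by move=> mn; rewrite /zr ltr_int; lia. Qed.

Lemma zr_abs m : zr (Z.abs m) = `|zr m|.
Proof.
case: (Z.abs_spec m) => -[h ->].
  by rewrite ger0_norm//; apply: (@zr_le 0).
by rewrite zrN ltr0_norm//; apply: (@zr_lt _ 0).
Qed.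

Variables (m a b : R).

Definition ev_affine (x : affine_form) : R := zr x.1 + zr x.2 * m.

Definition ev (g : qform) : R :=
  zr (c1 g) + zr (cm g) * m + zr (cs g) * m ^+ 2 + zr (ca g) * a + zr (cb g) *
    b.

Lemma ev_add g h : ev (add_form g h) = ev g + ev h.
Proof. rewrite /ev /= !zrD; ring. Qed.

Lemma ev_scale n g : ev (scale_form n g) = zr n * ev g.
Proof. rewrite /ev /= !zrM; ring. Qed.

Lemma ev_square x : ev (square_form x) = ev_affine x ^+ 2.
Proof. by rewrite /ev /ev_affine /= !zrM (_ : zr 2 = 2)// (_ : zr 0 = 0)//;
  ring. Qed.

Lemma ev_comb_affine w1 w2 w3 x1 x2 x3 :
  ev_affine (comb_affine w1 w2 w3 x1 x2 x3) =
  zr w1 * ev_affine x1 + zr w2 * ev_affine x2 + zr w3 * ev_affine x3.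
Proof. rewrite /ev_affine /= !zrD !zrM; ring. Qed.

Lemma refute_sound l C : `|m| <= 2 -> m ^+ 2 <= 2 -> `|a| <= 2 -> `|b| <= 2 ->
  (forall g, List.In g C -> ev g <= 0) -> refute l C -> False.
Proof.
move=> hm hs ha hb hC.
have hsum : ev (weighted_sum l C) <= 0.
  elim: l => [|[i w] l IH] /=; first by rewrite /ev /= !mul0r !addr0.
  rewrite ev_add ev_scale -[leRHS]addr0 lerD// mulr_ge0_le0//.
    by apply: (@zr_le 0); lia.
  move: (Z.to_nat i) => {}i; elim: C i hC {IH} => [|g C IH] [|i] hC /=.
  - by rewrite /ev /= !mul0r !addr0.
  - by rewrite /ev /= !mul0r !addr0.
  - by apply: hC; left.
  - by apply: IH => h hh; apply: hC; right.
rewrite /refute => /Z.ltb_lt /zr_lt; apply/negP; rewrite -leNgt.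
move: hsum; rewrite /ev zrM !zrD !zr_abs (_ : zr 2 = 2)//.
move: (weighted_sum l C) => g hsum.
have bnd (x y : R) : `|y| <= 2 -> - (x * y) <= 2 * `|x|.
  move=> hy; apply: le_trans (ler_norm _) _.
  by rewrite normrN normrM mulrC ler_wpM2r.
have := bnd (zr (cm g)) _ hm; have := bnd (zr (ca g)) _ ha.
have := bnd (zr (cb g)) _ hb.
have := bnd (zr (cs g)) (m ^+ 2); rewrite ger0_norm ?sqr_ge0// => /(_ hs).
lra.
Qed.

Lemma gap_sound x y : 79 <= m * 100 <= 101 ->
  `|ev_affine x - ev_affine y| * 100 <= zr (gap x y).
Proof.
move=> /andP[h1 h2]; set g := gap x y.
have /zr_le : Z.le (Z.abs (100 * (x.1 - y.1) + 79 * (x.2 - y.2)))%ZZ g.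
  by rewrite /g /gap; lia.
have /zr_le : Z.le (Z.abs (100 * (x.1 - y.1) + 101 * (x.2 - y.2)))%ZZ g.
  by rewrite /g /gap; lia.
rewrite !zr_abs !zrD !zrM !zrB !ler_norml (_ : zr 100 = 100)// (_ : zr 79 =
  79)//.
rewrite (_ : zr 101 = 101)// -[in X in _ -> _ -> X](@ger0_norm _ 100)//.
rewrite -normrM ler_norml /ev_affine.
move: (zr x.1) (zr x.2) (zr y.1) (zr y.2) (zr g) => x1 x2 y1 y2 G.
move=> /andP[A1 A2] /andP[B1 B2].
case: (leP 0 (x2 - y2)) => hx; apply/andP; split; nra.
Qed.

End Evaluation.

Arguments zr {R} n%_ZZ.

(** * Soundness of the checker *)

Lemma gap_le_width P1 P2 P3 : let n := width P1 P2 P3 in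
  [/\ (0 <= n)%ZZ, (gap P1.1 P2.1 <= n)%ZZ, (gap P1.1 P3.1 <= n)%ZZ
    & (gap P2.1 P3.1 <= n)%ZZ].
Proof.
have : (0 <= gap P1.1 P2.1)%ZZ by rewrite /gap; lia.
rewrite /width; move: (gap P1.1 P2.1) (gap P1.1 P3.1) (gap P2.1 P3.1) => x y z.
by split; lia.
Qed.

Lemma height_budget (j h1 h2 h3 N : nat) :
  (j + (maxn h1 (maxn h2 h3)).+1 <= N)%N ->
  [/\ (j.+1 <= N)%N, (j.+1 + h1 <= N)%N, (j.+1 + h2 <= N)%N
    & (j.+1 + h3 <= N)%N].
Proof. by move=> h; split; lia. Qed.

Lemma ev_chord {R : realType} (m a b : R) lo hi :
  ev m a b (chord lo hi) = (m * 100 - zr lo) * (m * 100 - zr hi).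
Proof.
rewrite /ev /chord /= zrN !zrM zrD (_ : zr 100 = 100)// (_ : zr 0 = 0)//; ring.
Qed.

Lemma ev_tangent {R : realType} (m a b : R) c :
  ev m a b (tangent c) = - (m * 100 - zr c) ^+ 2.
Proof.
rewrite /ev /tangent /= !zrN !zrM (_ : zr 100 = 100)// (_ : zr 0 = 0)//.
by rewrite (_ : zr 2 = 2)//; ring.
Qed.

Lemma range_constraints_sound {R : realType} (m a b : R) :
  79 <= m * 100 <= 101 -> forall g, List.In g range_constraints ->
    ev m a b g <= 0.
Proof.
have z0 : zr 0 = 0 :> R by [].
have z79 : zr 79 = 79 :> R by [].
have z101 : zr 101 = 101 :> R by [].
move=> /andP[m1 m2] g.
case=> [<-|[<-|[<-|[<-|[<-|[<-|[]]]]]]].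
- have n100 : zr (-100) = -100 :> R by [].
  by rewrite /ev /= z79 n100 z0; lra.
- have n101 : zr (-101) = -101 :> R by [].
  have z100 : zr 100 = 100 :> R by [].
  by rewrite /ev /= n101 z100 z0; lra.
- by rewrite ev_chord z79 z101 mulr_ge0_le0//; lra.
all: by rewrite ev_tangent oppr_le0 sqr_ge0.
Qed.

Section Soundness.
Context {R : realType}.
Implicit Types (t u : triangle R) (q v w : 'rV[R]_2).

(** The coordinates of the model enter only through this property. *)
Definition affine (h : 'rV[R]_2 -> R) :=
  forall c v w, h (c *: v + (1 - c) *: w) = c * h v + (1 - c) * h w.

Lemma affine_contraction h t q : affine h ->
  h (contraction t q) = (h (p1 t) + h (p2 t) + 2 * h q) / 4.
Proof.
move=> ah; have mid v w : h (midpoint v w) = (h v + h w) / 2.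
  rewrite /midpoint scalerDr (_ : 2^-1 *: w = (1 - 2^-1) *: w) ?ah;
    first by field.
  by congr (_ *: _); field.
by rewrite /contraction !mid; field.
Qed.

Lemma affine_reflection h t : affine h ->
  h (reflection t) = h (p1 t) + h (p2 t) - h (p3 t).
Proof.
move=> ah; rewrite /reflection /midpoint scalerA divff// scale1r.
have -> : p1 t + p2 t - p3 t = 2 *: (2^-1 *: p1 t + (1 - 2^-1) *: p2 t) + (1 -
  2) *: p3 t.
  rewrite scalerDr !scalerA divff// scale1r (_ : 2 * (1 - 2^-1) = 1);
    last by field.
  by rewrite scale1r (_ : 1 - 2 = -1) ?scaleN1r//; ring.
by rewrite !ah; field.
Qed.

Definition margin : R := (zr 10000)^-1.

Variables (f X Y : 'rV[R]_2 -> R) (T : nat -> triangle R) (N : nat).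
Variables (G : 'rV[R]_2 -> Prop) (m a b : R).

Let F v := Y v + X v ^+ 2.

Hypothesis affX : affine X.
Hypothesis affY : affine Y.
Hypothesis compare : forall v w, G v -> G w -> f v <= f w ->
  F v <= F w + margin.
Hypothesis inG : forall j, (j <= N)%N ->
  [/\ G (p1 (T j)), G (p2 (T j)), G (p3 (T j)) & G (reflection (T j))].
Hypothesis step : forall j, rnm_step f (T j) (T j.+1).
Hypothesis noshrink : forall j, accepted f (T j).
Hypothesis ordT : forall j, ordered f (T j).
Hypothesis mrange : 79 <= m * 100 <= 101.
Hypothesis abound : `|a| <= 2.
Hypothesis bbound : `|b| <= 2.

Definition represents k (P : spoint) v :=
  ev_affine m P.1 = 4 ^+ k * X v /\ ev m a b P.2 = 16 ^+ k * F v.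

Lemma represents_rescale k P v : represents k P v ->
  represents k.+1 (rescale P) v.
Proof.
move=> [h1 h2]; split; rewrite exprS -mulrA -?h1 -?h2 /rescale.
  by rewrite /ev_affine /= !zrM (_ : zr 4 = 4)//; ring.
by rewrite ev_scale.
Qed.

Lemma represents_contraction k P1 P2 P3 t q :
  represents k P1 (p1 t) -> represents k P2 (p2 t) -> represents k P3 q ->
  represents k.+1 (comb 1 1 2 P1 P2 P3)%ZZ (contraction t q).
Proof.
move=> [x1 g1] [x2 g2] [x3 g3];
  rewrite /represents /comb /F !affine_contraction//.
rewrite !ev_add ev_square !ev_scale !ev_add !ev_scale !ev_square ev_comb_affine.
rewrite g1 g2 g3 x1 x2 x3 /F !zrM !zrD (_ : zr 1 = 1)//.
rewrite (_ : zr (-1) = -1)// !exprS (_ : 16 = 4 * 4 :> R) ?exprMn; last by ring.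
by move: (4 ^+ k) => u; split; field.
Qed.

Lemma represents_reflection k P1 P2 P3 t :
  represents k P1 (p1 t) -> represents k P2 (p2 t) -> represents k P3 (p3 t) ->
  represents k (comb 1 1 (-1) P1 P2 P3)%ZZ (reflection t).
Proof.
move=> [x1 g1] [x2 g2] [x3 g3];
  rewrite /represents /comb /F !affine_reflection//.
rewrite !ev_add ev_square !ev_scale !ev_add !ev_scale !ev_square ev_comb_affine.
rewrite g1 g2 g3 x1 x2 x3 /F !zrM !zrD (_ : zr 1 = 1)//.
rewrite (_ : zr (-1) = -1)// (_ : 16 = 4 * 4 :> R) ?exprMn; last by ring.
by move: (4 ^+ k) => u; split; ring.
Qed.

Lemma le_form_sound k P Q v w : represents k P v -> represents k Q w ->
  G v -> G w -> f v <= f w -> ev m a b (le_form k P.2 Q.2) <= 0.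
Proof.
move=> [_ hv] [_ hw] Gv Gw /(compare Gv Gw) h.
rewrite /le_form !(ev_add, ev_scale) hv hw (_ : zr (-1) = -1)//.
have -> : ev m a b (QForm (- 16 ^ Z.of_nat k) 0 0 0 0)%ZZ = - 16 ^+ k :> R.
  by rewrite /ev /= zrN zrX (_ : zr 16 = 16)// (_ : zr 0 = 0)//; ring.
have u0 : 0 <= 16 ^+ k :> R by rewrite exprn_ge0.
have z0 : 0 < zr 10000 :> R by apply: (@zr_lt _ 0).
have : F v - F w <= (zr 10000)^-1 by rewrite lerBlDl.
rewrite -div1r ler_pdivlMr// => hh.
rewrite mulN1r -mulrBr addrC subr_le0 mulrCA -[leRHS]mulr1.
by rewrite ler_wpM2l// mulrC.
Qed.

(** The ratio det2 / width^6 has grown by (101/100)^2, where the addition of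
    1/20000 absorbs the extent in the normal direction. *)
Definition grown i := exists beta,
  [/\ 0 <= beta, edge_bound X (T i) beta
    & 101 ^+ 2 * (beta + (zr 20000)^-1) ^+ 6 * det2 (T 0%N)
      <= 100 ^+ 2 * det2 (T i)].

Lemma narrow_sound k P1 P2 P3 i :
  represents k P1 (p1 (T i)) -> represents k P2 (p2 (T i)) ->
  represents k P3 (p3 (T i)) -> det2 (T 0%N) = 4 ^+ k * det2 (T i) ->
  narrow k P1 P2 P3 -> grown i.
Proof.
move=> r1 r2 r3 hdet /Z.leb_le /(@zr_le R).
set n := width P1 P2 P3; set u := 4 ^+ k : R.
have u0 : 0 < u by rewrite exprn_gt0.
have [/(@zr_le R) n0 g12 g13 g23] := gap_le_width P1 P2 P3.
have edge P Q v w : represents k P v -> represents k Q w ->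
  (gap P.1 Q.1 <= n)%ZZ ->
    `|X v - X w| <= zr n / (100 * u).
  move=> [hv _] [hw _] /(@zr_le R) hn; rewrite ler_pdivlMr ?mulr_gt0//.
  apply: le_trans hn; apply: le_trans (gap_sound _ _ mrange).
  rewrite hv hw -mulrBr normrM (ger0_norm (ltW u0)) -/u.
  by rewrite [leRHS]mulrC [u * _]mulrC mulrCA.
rewrite (_ : 3%ZZ = Z.of_nat 3)// !(zrM, zrD, zrX).
rewrite (_ : zr 101 = 101)// (_ : zr 100 = 100)// (_ : zr 2 = 2)//.
rewrite (_ : zr 4 = 4)// (_ : zr 200 = 200)// -/u.
have z0 : 0 < zr 20000 :> R by apply: (@zr_lt _ 0).
move=> hn; exists (zr n / (100 * u)); split.
- by rewrite divr_ge0// mulr_ge0// ltW.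
- by split; [apply: edge r1 r2 _|apply: edge r1 r3 _|apply: edge r2 r3 _].
have d0 : 0 <= det2 (T i) by rewrite /det2 sqr_ge0.
have e20 : zr 20000 = 200 * 100 :> R.
  by rewrite (_ : 20000%ZZ = (200 * 100)%ZZ)// zrM.
pose s : R := zr n / (100 * u) + (zr 20000)^-1; rewrite -/s; have s0 : 0 <= s.
  by rewrite addr_ge0 ?invr_ge0 ?(ltW z0)// divr_ge0// mulr_ge0// ltW.
have hs : 200 * zr n + u = s * (zr 20000 * u).
  rewrite /s e20; field.
  by rewrite (gt_eqF u0).
have h3 : 101 * 2 ^+ k * s ^+ 3 <= 100.
  rewrite -(ler_pM2r (_ : 0 < (zr 20000 * u) ^+ 3)) ?exprn_gt0 ?mulr_gt0//.
  by move: hn; rewrite hs (exprMn _ s) mulrA.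
have : (101 * 2 ^+ k * s ^+ 3) ^+ 2 <= 100 ^+ 2.
  by rewrite lerXn2r// ?nnegrE ?mulr_ge0// exprn_ge0.
rewrite !exprMn -!exprM (mulnC k 2) exprM (_ : 2 ^+ 2 = 4 :> R); last by ring.
rewrite -/u => h4; rewrite hdet -/u.
have -> : 101 ^+ 2 * s ^+ 6 * (u * det2 (T i)) = 101 ^+ 2 * u * s ^+ 6 * det2
  (T i).
  by ring.
apply: ler_wpM2r => //.
by rewrite (_ : s ^+ 6 = s ^+ 2 * (s ^+ 2 * s ^+ 2)) //; ring.
Qed.

Let hold C := forall g, List.In g C -> ev m a b g <= 0.

Lemma hold_cons g C : ev m a b g <= 0 -> hold C -> hold (g :: C).
Proof. by move=> hg hC h /= [<-//|]; apply: hC. Qed.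

Lemma refuted l C : hold C -> refute l C -> False.
Proof.
apply: refute_sound => //; move: mrange => /andP[h1 h2].
  by rewrite ler_norml; lra.
by nra.
Qed.

(** Induction on the tree, for both meanings of a node at once: the branch
    taken by the run is one of those checked, and its comparison of values is
    the constraint added by the checker. *)
Lemma check_sound (t : tree) :
  (forall k P1 P2 P3 C j, check t k P1 P2 P3 None C -> hold C ->
    represents k P1 (p1 (T j)) -> represents k P2 (p2 (T j)) ->
    represents k P3 (p3 (T j)) -> det2 (T 0%N) = 4 ^+ k * det2 (T j) ->
    (j + height t <= N)%N -> exists2 i, (i <= N)%N & grown i) /\
  (forall k P1 P2 P3 C j q r, check t k P1 P2 P3 (Some r) C -> hold C ->
    T j.+1 = replace_worst f (T j) q -> (r -> f q < f (p2 (T j))) ->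
    represents k P1 (p1 (T j)) -> represents k P2 (p2 (T j)) ->
    represents k P3 q -> det2 (T 0%N) = 4 ^+ k * det2 (T j.+1) ->
    (j + height t <= N)%N -> exists2 i, (i <= N)%N & grown i).
Proof.
elim: t => [|l|t1 [IHs1 IHi1] t2 [IHs2 IHi2] t3 [IHs3 IHi3]]; split => //=.
- move=> k P1 P2 P3 C j hn _ h1 h2 h3 hd; rewrite addn0 => jN.
  by exists j => //; apply: narrow_sound h1 h2 h3 hd hn.
- by move=> k P1 P2 P3 C j + hC => /(refuted hC).
- by move=> k P1 P2 P3 C j q r + hC => /(refuted hC).
- move=> k P1 P2 P3 C j /and3P[c1 c2 c3] hC h1 h2 h3 hd.
  move=> /height_budget[jN1 /ltnW N1 /ltnW N2 /ltnW N3].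
  have [G1 G2 G3 Gr] : [/\ G (p1 (T j)), G (p2 (T j)), G (p3 (T j))
      & G (reflection (T j))] by apply/inG/ltnW.
  have hr := represents_reflection h1 h2 h3.
  have /andP[le12 le23] := ordT j.
  case: (rnm_stepP (noshrink j) (step j)) => [[hf E]|[hf hf' E]|[/andP[hf hf']
    E]].
  + apply: (IHi1 _ _ _ _ _ _ _ _ c1 _ E) => //.
      by apply: hold_cons => //; apply: le_form_sound hr h2 _ _ _ => //;
        exact: ltW.
    by rewrite E det2_reflection.
  + apply: (IHi2 _ _ _ _ _ _ _ _ c2 _ E) => //.
    * by apply: hold_cons => //; apply: le_form_sound h3 hr _ _ _.
    * exact: represents_rescale.
    * exact: represents_rescale.
    * exact: represents_contraction.
    * by rewrite hd E exprS (@det2_contraction _ f _ (p3 (T j))); [ring|left].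
  + apply: (IHi3 _ _ _ _ _ _ _ _ c3 _ E) => //.
    * apply: hold_cons; first exact: le_form_sound h2 hr _ _ _.
      by apply: hold_cons => //; apply: le_form_sound hr h3 _ _ _ => //;
        exact: ltW.
    * exact: represents_rescale.
    * exact: represents_rescale.
    * exact: represents_contraction.
    * by rewrite hd E exprS (@det2_contraction _ f _ (reflection (T j)));
      [ring|right].
- move=> k P1 P2 P3 C j q r /and3P[c1 c2 c3] hC E hrf h1 h2 h3 hd.
  move=> /height_budget[jN1 N1 N2 N3].
  have [G1 G2 G3 _] : [/\ G (p1 (T j.+1)), G (p2 (T j.+1)), G (p3 (T j.+1))
      & G (reflection (T j.+1))] by apply: inG.
  have /andP[le12 _] := ordT j.
  case: (replace_worstP q le12) => -[hf]; rewrite -E => Ej;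
    rewrite Ej /= in G1 G2 G3.
  + apply: (IHs1 _ _ _ _ _ j.+1 c1); rewrite ?Ej//; last by rewrite -Ej.
    by apply: hold_cons => //; apply: le_form_sound h3 h1 _ _ _ => //;
      exact: ltW.
  + move/andP: hf => [hf hf'].
    apply: (IHs2 _ _ _ _ _ j.+1 c2); rewrite ?Ej//; last by rewrite -Ej.
    apply: hold_cons; first exact: le_form_sound h1 h3 _ _ _.
    by apply: hold_cons => //; apply: le_form_sound h3 h2 _ _ _ => //;
      exact: ltW.
  + case/orP: c3 => [/hrf|c3]; first by rewrite ltNge hf.
    apply: (IHs3 _ _ _ _ _ j.+1 c3); rewrite ?Ej//; last by rewrite -Ej.
    by apply: hold_cons => //; apply: le_form_sound h2 h3 _ _ _.
Qed.

(** [L] is the end vertex put at 0 and [M] the other retained vertex; the worst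
    vertex is at 1, and the first move is an inside contraction. *)
Lemma block_growth L M : (23 <= N)%N ->
  f (p3 (T 0%N)) <= f (reflection (T 0%N)) ->
  (p1 (T 0%N), p2 (T 0%N)) = (L, M) \/ (p1 (T 0%N), p2 (T 0%N)) = (M, L) ->
  X (p3 (T 0%N)) = 1 -> [/\ X L = 0, Y L = 0, m = X M,
    a = F M & b = F (p3 (T 0%N))] ->
  exists2 i, (i <= N)%N & grown i.
Proof.
move=> N23 hr hLM XQ [xL yL mM aM bQ].
have [G1 G2 G3 Gr] : [/\ G (p1 (T 0%N)), G (p2 (T 0%N)), G (p3 (T 0%N))
      & G (reflection (T 0%N))] by apply: inG.
have /andP[le12 le23] := ordT 0%N.
have E : T 1%N = replace_worst f (T 0%N) (contraction (T 0%N) (p3 (T 0%N))).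
  case: (rnm_stepP (noshrink 0%N) (step 0%N)) => [[hf _]|[_ _ ->//]|[/andP[_
    hf] _]].
    by move: (le_lt_trans (le_trans le23 hr) hf); rewrite ltxx.
  by move: (le_lt_trans hr hf); rewrite ltxx.
have hd : det2 (T 0%N) = 4 ^+ 1 * det2 (T 1%N).
  by rewrite expr1 E -det2_contraction//; left.
have check_tree tr A B : root_check tr A B ptQ -> (height tr <= N)%N ->
    represents 0 A (p1 (T 0%N)) -> represents 0 B (p2 (T 0%N)) ->
    represents 0 ptQ (p3 (T 0%N)) -> exists2 i, (i <= N)%N & grown i.
  move=> hc hN hA hB hQ.
  apply: ((check_sound tr).2 _ _ _ _ _ _ _ _ hc _ E) => //.
  - have hR := represents_reflection hA hB hQ.
    apply: hold_cons; first exact: le_form_sound hQ hR _ _ _.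
    apply: hold_cons; first exact: le_form_sound hA hB _ _ _.
    apply: hold_cons; first exact: le_form_sound hB hQ _ _ _.
    exact: range_constraints_sound.
  - exact: represents_rescale.
  - exact: represents_rescale.
  - exact: represents_contraction.
have repL : represents 0 ptL L.
  rewrite /represents /F xL yL /ev_affine /ev /=.
  by rewrite (_ : zr 0 = 0)//; split; ring.
have repM : represents 0 ptM M.
  rewrite /represents -mM -aM /ev_affine /ev /=.
  by rewrite (_ : zr 0 = 0)// (_ : zr 1 = 1)//; split; ring.
have repQ : represents 0 ptQ (p3 (T 0%N)).
  rewrite /represents -bQ XQ /ev_affine /ev /=.
  by rewrite (_ : zr 0 = 0)// (_ : zr 1 = 1)//; split; ring.
case: hLM => -[e1 e2].
- by apply: check_tree root_LM _ _ _ _; rewrite ?e1 ?e2//; apply: leq_trans N23.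
- by apply: check_tree root_ML _ _ _ _; rewrite ?e1 ?e2//; apply: leq_trans N23.
Qed.

End Soundness.

(** * Growth in the model *)

Section ModelGrowth.
Context {R : realType}.
Variables (f X Y : 'rV[R]_2 -> R) (T : nat -> triangle R) (N : nat).
Variable G : 'rV[R]_2 -> Prop.

Lemma zr_inv_le n : (1000 <=? n)%ZZ -> 0 < (zr n : R)^-1 <= 1 / 1000.
Proof.
have z1000 : zr 1000 = 1000 :> R by [].
have p1000 : 0 < zr 1000 :> R by apply: (@zr_lt R 0).
move=> /Z.leb_le /(@zr_le R) hn; have n0 := lt_le_trans p1000 hn.
rewrite invr_gt0 n0 /= -[X in X <= _]div1r ler_pdivrMr// -z1000 mulrAC.
by rewrite ler_pdivlMr// !mul1r.
Qed.

(** Numerically 2 (101/100) (79/100 + 1/1000)^3 < 1, so that one contraction is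
    enough when m < 79/100. *)
Lemma pow6_bound (s : R) : 0 <= s <= 791 / 1000 ->
  101 ^+ 2 * s ^+ 6 * 4 <= 100 ^+ 2.
Proof.
move=> /andP[s0 s1].
have s2 : s ^+ 2 <= 626 / 1000 by nra.
have s3 : s * s ^+ 2 <= 495 / 1000 by nra.
have s3p : 0 <= s * s ^+ 2 by rewrite mulr_ge0// sqr_ge0.
have : (202 * (s * s ^+ 2)) ^+ 2 <= 100 ^+ 2.
  by rewrite lerXn2r ?nnegrE//; lra.
by apply: le_trans; rewrite le_eqVlt; apply/orP; left; apply/eqP; ring.
Qed.

Lemma contracted_width (m : R) : - (1 / 4) <= m -> m * 100 < 79 ->
  [/\ `|m - 0| <= 79 / 100, `|(m + 2) / 4 - 0| <= 79 / 100
    & `|(m + 2) / 4 - m| <= 79 / 100].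
Proof. by move=> m0 m1; split; rewrite ler_norml; apply/andP; split; lra. Qed.

(** That the worst vertex is not better than its reflection bounds [m] by 1 +
    O(margin) and confines [a] and [b]; it remains to separate the range of the
    case tree from the range where one contraction suffices. *)
Lemma model_growth L M : affine X -> affine Y ->
  (forall v w, G v -> G w -> f v <= f w ->
    Y v + X v ^+ 2 <= Y w + X w ^+ 2 + margin) ->
  (forall j, (j <= N)%N ->
    [/\ G (p1 (T j)), G (p2 (T j)), G (p3 (T j)) & G (reflection (T j))]) ->
  (forall j, rnm_step f (T j) (T j.+1)) -> (forall j, accepted f (T j)) ->
  (forall j, ordered f (T j)) -> (23 <= N)%N ->
  f (p3 (T 0%N)) <= f (reflection (T 0%N)) ->
  (p1 (T 0%N), p2 (T 0%N)) = (L, M) \/ (p1 (T 0%N), p2 (T 0%N)) = (M, L) ->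
  X (p3 (T 0%N)) = 1 -> X L = 0 -> Y L = 0 -> - (1 / 4) <= X M ->
  exists2 i, (i <= N)%N & grown X T i.
Proof.
move=> aX aY cmp inG st acc ord N23 hr hLM XQ XL YL XM0.
have [G1 G2 G3 Gr] : [/\ G (p1 (T 0%N)), G (p2 (T 0%N)), G (p3 (T 0%N))
      & G (reflection (T 0%N))] by apply: inG.
have /andP[le12 le23] := ord 0%N.
have := cmp _ _ G3 Gr hr; rewrite !affine_reflection//.
have [le13' le23'] : f L <= f (p3 (T 0%N)) /\ f M <= f (p3 (T 0%N)).
  by case: hLM => -[<- <-]; split=> //; apply: le_trans le23.
have [GL GM] : G L /\ G M by case: hLM => -[<- <-].
have := cmp _ _ GL G3 le13'; have := cmp _ _ GM G3 le23'.
set Q := p3 (T 0%N) in XQ G3 *.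
have -> : X (p1 (T 0%N)) + X (p2 (T 0%N)) - X Q = X M - 1.
  by rewrite XQ; case: hLM => -[-> ->]; rewrite XL ?add0r ?addr0.
have -> : Y (p1 (T 0%N)) + Y (p2 (T 0%N)) - Y Q = Y M - Y Q.
  by case: hLM => -[-> ->]; rewrite YL ?add0r ?addr0.
rewrite XQ XL YL.
have /andP[e0 e1] := @zr_inv_le 10000 isT; rewrite -/(@margin R) in e0 e1.
set m := X M in XM0 *; set e := margin in e0 e1 *.
move=> c1 c2 c3.
have m101 : m * 100 <= 101 by lra.
case: (leP 79 (m * 100)) => [m79|m79].
  apply: (@block_growth R f X Y T N G m (Y M + m ^+ 2) (Y Q + X Q ^+ 2) aX aY
    cmp inG st acc ord _ _ _ L M) => //.
  - by rewrite m79.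
  - rewrite ler_norml; apply/andP; split; lra.
  - rewrite XQ ler_norml; apply/andP; split; lra.
have E : T 1%N = replace_worst f (T 0%N) (contraction (T 0%N) Q).
  case: (rnm_stepP (acc 0%N) (st 0%N)) => [[hf _]|[_ _ ->//]|[/andP[_ hf] _]].
    by move: (le_lt_trans (le_trans le23 hr) hf); rewrite ltxx.
  by move: (le_lt_trans hr hf); rewrite ltxx.
exists 1%N; first by apply: leq_trans N23.
have /andP[w0 w1] := @zr_inv_le 20000 isT.
exists (79 / 100); split; first by lra.
- have [b1 b2 b3] := contracted_width XM0 m79.
  have Xn : X (contraction (T 0%N) Q) = (m + 2) / 4.
    rewrite affine_contraction// XQ.
    by case: hLM => -[-> ->]; rewrite XL /m ?add0r ?addr0 mulr1.
  have [[x1 x2]|[x1 x2]] : (X (p1 (T 0%N)) = 0 /\ X (p2 (T 0%N)) = m) \/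
                 (X (p1 (T 0%N)) = m /\ X (p2 (T 0%N)) = 0).
    by case: hLM => -[-> ->]; [left|right].
  by case: (replace_worstP (contraction (T 0%N) Q) le12) => -[_];
    rewrite -E => ->;
    rewrite /edge_bound /= Xn x1 x2; split => //; rewrite distrC.
  by case: (replace_worstP (contraction (T 0%N) Q) le12) => -[_];
    rewrite -E => ->;
    rewrite /edge_bound /= Xn x1 x2; split => //; rewrite distrC.
rewrite (@det2_contraction _ f (T 0%N) Q); last by left.
rewrite -E mulrA ler_wpM2r ?sqr_ge0//; apply: pow6_bound; lra.
Qed.

End ModelGrowth.

(** * Local expansion and slope *)

Section LocalExpansion.
Context {R : realType}.
Implicit Types (f : 'rV[R]_2 -> R) (x y v : 'rV[R]_2).

Lemma norm_row2_le v (e : R) : 0 <= e ->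
  (`|v| <= e) = (`|v 0 0| <= e) && (`|v 0 1| <= e).
Proof.
move=> e0; apply/idP/andP => [h|[h0 h1]].
  have coord (j : 'I_2) : `|v 0 j| <= `|v|.
    rewrite [leRHS]/Num.norm /= mx_normrE; apply/bigmax_geP; right => /=.
    by exists (0, j).
  by split; apply: le_trans h.
rewrite [leLHS]/Num.norm /= mx_normrE; apply/bigmax_leP;
  split => // -[i j] _ /=.
by rewrite (ord1 i); case: (ord2E j) => ->.
Qed.

Lemma norm_le_of_sqn v (e : R) : 0 <= e -> sqn v <= e ^+ 2 -> `|v| <= e.
Proof.
move=> e0 h; rewrite norm_row2_le//; have := sqr_ge0 (v 0 0);
  have := sqr_ge0 (v 0 1).
move: h; rewrite /sqn => h h1 h0.
by apply/andP; split;
  rewrite -(@ler_pXn2r _ 2)// ?nnegrE// -normrX ger0_norm ?sqr_ge0//; lra.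
Qed.

Lemma sqn_le_of_norm v (e : R) : 0 <= e -> `|v| <= e -> sqn v <= 2 * e ^+ 2.
Proof.
move=> e0; rewrite norm_row2_le// => /andP[h0 h1].
have sq (x : R) : `|x| <= e -> x ^+ 2 <= e ^+ 2.
  by move=> h; rewrite -[leLHS]ger0_norm ?sqr_ge0// normrX lerXn2r ?nnegrE.
have := sq _ h0; have := sq _ h1; rewrite /sqn; lra.
Qed.

Lemma hessian_modulus f (rho eta : R) : C2 f -> 0 < eta ->
  exists2 r : R, 0 < r & forall x y v, `|x| <= rho -> `|y - x| <= r ->
    `|quad f y v - quad f x v| <= eta * sqn v.
Proof.
move=> C2f eta0; have eta2 : 0 < eta / 2 by rewrite divr_gt0.
pose K := [set x : 'rV[R]_2 | `|x| <= rho].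
have md i j := uniform_on_compact (@closed_ball_compact R rho)
  (@hessian_continuous R f i j C2f) eta2.
have [r00 p00 h00] := md 0 0; have [r01 p01 h01] := md 0 1.
have [r10 p10 h10] := md 1 0; have [r11 p11 h11] := md 1 1.
exists (Num.min (Num.min r00 r01) (Num.min r10 r11)).
  by rewrite !lt_min p00 p01 p10 p11.
move=> x y v hx; rewrite !le_min => /andP[/andP[y00 y01] /andP[y10 y11]].
have := h00 x y hx y00; have := h01 x y hx y01.
have := h10 x y hx y10; have := h11 x y hx y11; rewrite /sqn !quadE.
move: (hessian f x) (hessian f y) => H G.
move: (H 0 0) (H 0 1) (H 1 0) (H 1 1) (G 0 0) (G 0 1) (G 1 0) (G 1 1) (v 0 0)
  (v 0 1).
move=> a b c d a' b' c' d' p q hd hc hb ha.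
have -> : p * (p * a' + q * b') + q * (p * c' + q * d') -
    (p * (p * a + q * b) + q * (p * c + q * d)) =
    p ^+ 2 * (a' - a) + p * q * ((b' - b) + (c' - c)) + q ^+ 2 * (d' - d) by
      ring.
have t1 : `|p ^+ 2 * (a' - a)| <= p ^+ 2 * (eta / 2).
  by rewrite normrM ger0_norm ?sqr_ge0// ler_wpM2l ?sqr_ge0.
have t3 : `|q ^+ 2 * (d' - d)| <= q ^+ 2 * (eta / 2).
  by rewrite normrM ger0_norm ?sqr_ge0// ler_wpM2l ?sqr_ge0.
have t2 : `|p * q * ((b' - b) + (c' - c))| <= (p ^+ 2 + q ^+ 2) / 2 * eta.
  rewrite normrM; apply: ler_pM => //.
    rewrite ler_norml; apply/andP; split.
      by have := sqr_ge0 (p + q); lra.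
    by have := sqr_ge0 (p - q); lra.
  by apply: le_trans (ler_normD _ _) _; lra.
apply: le_trans (ler_normD _ _) _;
  apply: le_trans (lerD (ler_normD _ _) (lexx _)) _.
lra.
Qed.

Lemma second_order_expansion f (rho eta r : R) x v : C2 f ->
  (forall x y v, `|x| <= rho -> `|y - x| <= r ->
    `|quad f y v - quad f x v| <= eta * sqn v) ->
  `|x| <= rho -> `|v| <= r ->
  `|f (x + v) - (f x + grad f x v + quad f x v / 2)| <= eta / 2 * sqn v.
Proof.
move=> C2f hmod hx hv.
have close t : 0 <= t <= 1 ->
  `|quad f (x + t *: v) v - quad f x v| <= eta * sqn v.
  move=> /andP[t0 t1]; apply: hmod => //;
    rewrite addrC addKr normrZ ger0_norm//.
  by apply: le_trans hv; rewrite ler_piMl.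
have lo t : 0 <= t <= 1 -> quad f x v - eta * sqn v <= quad f (x + t *: v) v.
  by move=> /close; rewrite ler_distl => /andP[].
have hi t : 0 <= t <= 1 -> quad f (x + t *: v) v <= quad f x v + eta * sqn v.
  by move=> /close; rewrite ler_distl => /andP[].
have := taylor_ge C2f lo; have := taylor_le C2f hi; rewrite ler_distl.
move: (quad f x v) (sqn v) (f x) (f (x + v)) (grad f x v) => q s a b g h1 h2.
by apply/andP; split; lra.
Qed.

Definition slope2 f x : R := 'D_('e_0) f x ^+ 2 + 'D_('e_1) f x ^+ 2.

(** Convexity: from [x] the value can only drop by [al - f z] over a bounded
    distance if the slope is bounded below. *)
Lemma slope2_lower_bound f (rho al : R) z : classF f -> 0 <= rho ->
  `|z| <= rho ->
  f z < al -> exists2 gam : R, 0 < gam & forall x, `|x| <= rho ->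
    al <= f x -> gam <= slope2 f x.
Proof.
move=> cf rho0 hz fz; have [C2f _ _] := cf.
have [mu [M [mu0 _ curved]]] := hessian_bounds rho0 cf.
pose L := 2 * (2 * rho) ^+ 2 + 1.
have L0 : 0 < L by rewrite ltr_wpDl// mulr_ge0 ?sqr_ge0.
have d0 : 0 < al - f z by lra.
exists ((al - f z) ^+ 2 / L); first by rewrite divr_gt0// exprn_gt0.
move=> x hx fx; rewrite ler_pdivrMr//.
have := above_tangent C2f curved hx hz.
have s0 := sqn_ge0 (z - x);
  have m0 : 0 <= mu / 2 * sqn (z - x) by rewrite mulr_ge0//; lra.
have sL : sqn (z - x) <= L.
  apply: (@le_trans _ _ (2 * (2 * rho) ^+ 2)); last by rewrite lerDl.
  apply: sqn_le_of_norm; first lra.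
  by apply: le_trans (ler_normB _ _) _; lra.
have gL : (al - f z) <= - grad f x (z - x) -> (al - f z) ^+ 2 <= slope2 f x * L.
  move=> h; apply: (@le_trans _ _ (slope2 f x * sqn (z - x))); last first.
    by rewrite ler_wpM2l// addr_ge0 ?sqr_ge0.
  apply: (@le_trans _ _ ((- grad f x (z - x)) ^+ 2));
    first by rewrite lerXn2r ?nnegrE//; lra.
  rewrite sqrrN /grad /slope2 /sqn.
  move: ('D_'e_0 f x) ('D_'e_1 f x) ((z - x) 0 0) ((z - x) 0 1) => a b p q.
  by rewrite -subr_ge0 (_ : _ - _ = (p * b - q * a) ^+ 2) ?sqr_ge0//; ring.
by move=> h; apply: gL; lra.
Qed.

End LocalExpansion.

(** * Affine functions along a run, and a split of quadratic forms *)

Section AffineOrbit.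
Context {R : realType}.
Implicit Types (f h : 'rV[R]_2 -> R) (t u : triangle R).

Lemma edge_bound_insert h f t q e : edge_bound h (Triangle (p1 t) (p2 t) q) e ->
  edge_bound h (replace_worst f t q) e /\
  `|h (p1 (replace_worst f t q)) - h (p1 t)| <= e.
Proof.
move=> [/= e12 e13 e23]; have e0 : 0 <= e by apply: le_trans e12.
rewrite /edge_bound /replace_worst; do 2?case: ifP => _;
  by rewrite /= ?subrr ?normr0; do ?split => //; rewrite distrC.
Qed.

Lemma edge_bound_step h f t u e : affine h ->
  reflects f t u \/ contracts f t u ->
  edge_bound h t e -> edge_bound h u e /\ `|h (p1 u) - h (p1 t)| <= e.
Proof.
move=> ah st [e12 e13 e23].
have refl : edge_bound h (Triangle (p1 t) (p2 t) (reflection t)) e.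
  split=> //=; rewrite affine_reflection//.
    by rewrite (_ : _ - _ = - (h (p2 t) - h (p3 t))) ?normrN//; ring.
  by rewrite (_ : _ - _ = - (h (p1 t) - h (p3 t))) ?normrN//; ring.
have contr q : edge_bound h (Triangle (p1 t) (p2 t) q) e ->
    edge_bound h (Triangle (p1 t) (p2 t) (contraction t q)) e.
  move=> [/= _]; rewrite !ler_norml => /andP[h1 h2] /andP[h3 h4].
  move: (e12); rewrite ler_norml => /andP[h5 h6].
  split; rewrite /= ?affine_contraction// ler_norml; apply/andP; split; lra.
case: st => [[_ ->]|[q [hq _ _ _ ->]]]; apply: edge_bound_insert => //.
by apply: contr; case: hq => ->.
Qed.

(** The extent in a given direction never increases, and each step moves the
    best vertex by at most this extent; so a run cannot go far in few steps. *)
Lemma affine_orbit h f (T : nat -> triangle R) e : affine h ->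
  (forall j, reflects f (T j) (T j.+1) \/ contracts f (T j) (T j.+1)) ->
  edge_bound h (T 0%N) e -> `|h (p1 (T 0%N))| <= e ->
  forall j, edge_bound h (T j) e /\ forall v, v = p1 (T j) \/ v = p2 (T j) \/
    v = p3 (T j) \/ v = reflection (T j) -> `|h v| <= e *+ j.+2.
Proof.
move=> ah st e0 h0.
have orbit j : edge_bound h (T j) e /\ `|h (p1 (T j))| <= e *+ j.+1.
  elim: j => [|j [IH1 IH2]]; first by rewrite mulr1n.
  have [h1 h2] := edge_bound_step ah (st j) IH1; split=> //.
  rewrite -(subrK (h (p1 (T j))) (h (p1 (T j.+1)))).
  by apply: le_trans (ler_normD _ _) _; rewrite mulrS lerD.
move=> j; have [hj hp] := orbit j; split=> // v hv.
rewrite -(subrK (h (p1 (T j))) (h v)); apply: le_trans (ler_normD _ _) _.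
rewrite mulrS lerD//; case: hj => e12 e13 e23.
case: hv => [->|[->|[->|->]]]; rewrite ?subrr ?normr0 1?distrC//.
  exact: le_trans e12.
rewrite affine_reflection// (_ : _ - _ = - (h (p2 (T j)) - h (p3 (T j))))
  ?normrN//; ring.
Qed.

End AffineOrbit.

Section QuadraticForm.
Context {R : realType}.
Variables (A B C M : R).

Let q (x y : R) := A * x ^+ 2 + B * (x * y) + C * y ^+ 2.

(** In the orthogonal frame of the gradient (g0, g1) and the tangent, only the
    tangential square is kept. The mixed term is bounded by positivity of the
    form at lam nu g +- tau g^perp, which leaves the free parameter [lam] to
    make the tangential part of the error small. *)
Lemma quad_split (g0 g1 d0 d1 lam : R) :
  (forall x y, 0 <= q x y <= M * (x ^+ 2 + y ^+ 2)) -> 0 < lam ->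
  let n := g0 ^+ 2 + g1 ^+ 2 in let tau := - g1 * d0 + g0 * d1 in
  let nu := g0 * d0 + g1 * d1 in 0 < n ->
  `|q d0 d1 - q (- g1) g0 / n ^+ 2 * tau ^+ 2| <=
    M / n * ((1 + lam) * nu ^+ 2 + tau ^+ 2 / lam).
Proof.
move=> hq lam0 n tau nu n0.
have nN : n != 0 by rewrite gt_eqF.
pose S := - 2 * A * g0 * g1 + B * (g0 ^+ 2 - g1 ^+ 2) + 2 * C * g0 * g1.
have polar a b : q (a * g0 - b * g1) (a * g1 + b * g0) =
    a ^+ 2 * q g0 g1 + a * b * S + b ^+ 2 * q (- g1) g0 by rewrite /q /S; ring.
have E : q d0 d1 - q (- g1) g0 / n ^+ 2 * tau ^+ 2 =
    (nu ^+ 2 * q g0 g1 + nu * tau * S) / n ^+ 2.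
  have -> : q d0 d1 = q (nu * g0 - tau * g1) (nu * g1 + tau * g0) / n ^+ 2.
    by rewrite /q /nu /tau /n; field; exact: nN.
  by rewrite polar; field.
rewrite E normrM (@ger0_norm _ (n ^+ 2)^-1) ?invr_ge0 ?sqr_ge0//.
rewrite ler_pdivrMr ?exprn_gt0//.
have -> : M / n * ((1 + lam) * nu ^+ 2 + tau ^+ 2 / lam) * n ^+ 2 =
   nu ^+ 2 * (M * n) + (lam * nu ^+ 2 * (M * n) + tau ^+ 2 * (M * n) / lam).
  by field; rewrite nN gt_eqF.
have /andP[g_ge g_le] := hq g0 g1; have /andP[p_ge p_le] := hq (- g1) g0.
have {}p_le : q (- g1) g0 <= M * n by move: p_le; rewrite sqrrN addrC.
have P1 := hq (lam * nu * g0 - tau * g1) (lam * nu * g1 + tau * g0).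
have P2 := hq (lam * nu * g0 - (- tau) * g1) (lam * nu * g1 + (- tau) * g0).
have a1 : lam * `|nu * tau * S| <= (lam * nu) ^+ 2 * (M * n) + tau ^+ 2 * (M *
  n).
  have b1 : (lam * nu) ^+ 2 * q g0 g1 <= (lam * nu) ^+ 2 * (M * n) by rewrite
    ler_wpM2l ?sqr_ge0.
  have b2 : tau ^+ 2 * q (- g1) g0 <= tau ^+ 2 * (M * n) by rewrite ler_wpM2l
    ?sqr_ge0.
  have /andP[c1 _] := P1; have /andP[c2 _] := P2; move: c1 c2;
    rewrite !polar => c1 c2.
  by case: (ger0P (nu * tau * S)) => _; lra.
apply: le_trans (ler_normD _ _) _; apply: lerD.
  by rewrite normrM !ger0_norm ?sqr_ge0// ler_wpM2l ?sqr_ge0.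
rewrite -(ler_pM2l lam0); apply: le_trans a1 _; rewrite le_eqVlt; apply/orP;
  left.
by apply/eqP; field; rewrite gt_eqF.
Qed.

End QuadraticForm.

(** * Growth of the shape ratio for the objective function *)

Section BlockNumerics.
Context {R : realType}.
Variables (eta M n lam e mu kt u X Y A B D kap gam : R).

(** The four contributions to the error (tangential and normal, from the
    variation of the Hessian and from the terms dropped by [quad_split]) are
    each at most an eighth of [kap * e]. *)
Lemma rest_bound : 0 < n -> 0 < lam -> 0 < e -> 0 <= eta -> 0 <= M -> 0 < kap ->
  gam <= n -> kap = kt * u ^+ 2 / 2 -> mu <= kt * n -> kap <= M * D / 2 ->
  X ^+ 2 <= A -> Y ^+ 2 <= B -> 0 <= D ->
  8 * eta * A <= mu * e -> 8 * M * A <= lam * (mu * e) ->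
  2 * eta * M * B * D <= gam * e -> 2 * (1 + lam) * M ^+ 2 * B * D <= gam * e ->
  eta / 2 * (((u * X) ^+ 2 + (kap * Y) ^+ 2) / n) +
  (M / n * ((1 + lam) * (kap * Y) ^+ 2 + (u * X) ^+ 2 / lam)) / 2 <= kap * e /
    2.
Proof.
move=> n0 lam0 e0 eta0 M0 kap0 gn Ek mk kM XA YB D0 h1 h2 h3 h4.
have X0 := sqr_ge0 X; have Y0 := sqr_ge0 Y; have u0 := sqr_ge0 u.
have B0 : 0 <= B by exact: le_trans YB.
have ge : gam * e <= n * e by rewrite ler_wpM2r// ltW.
have me : mu * e <= kt * n * e by rewrite ler_wpM2r// ltW.
have kB : 2 * kap * B <= M * D * B by rewrite ler_wpM2r//; lra.
have P1 : eta * X ^+ 2 * 8 <= kt * n * e.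
  by have := ler_wpM2l eta0 XA; lra.
have P4 : M * X ^+ 2 * 8 <= lam * (kt * n * e).
  have := ler_wpM2l M0 XA; have := ler_wpM2l (ltW lam0) me; lra.
have P2 : 4 * eta * (kap * Y ^+ 2) <= n * e.
  have : eta * (kap * Y ^+ 2) <= eta * (kap * B).
    by rewrite ler_wpM2l// ler_wpM2l// ltW.
  by have := ler_wpM2l eta0 kB; lra.
have lM0 : 0 <= (1 + lam) * M by rewrite mulr_ge0//; lra.
have P3 : 4 * ((1 + lam) * M) * (kap * Y ^+ 2) <= n * e.
  have : (1 + lam) * M * (kap * Y ^+ 2) <= (1 + lam) * M * (kap * B).
    by rewrite ler_wpM2l// ler_wpM2l// ltW.
  by have := ler_wpM2l lM0 kB; lra.
have -> : eta / 2 * (((u * X) ^+ 2 + (kap * Y) ^+ 2) / n) +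
  (M / n * ((1 + lam) * (kap * Y) ^+ 2 + (u * X) ^+ 2 / lam)) / 2 =
  (u ^+ 2 * (eta * X ^+ 2 * 8) / 16 + kap * (4 * eta * (kap * Y ^+ 2)) / 8 +
   kap * (4 * ((1 + lam) * M) * (kap * Y ^+ 2)) / 8 +
   u ^+ 2 * (M * X ^+ 2 * 8) / lam / 16) / n by field; rewrite !gt_eqF.
rewrite ler_pdivrMr//.
have Q1 := ler_wpM2l u0 P1; have Q4 := ler_wpM2l u0 P4.
have Q2 := ler_wpM2l (ltW kap0) P2; have Q3 := ler_wpM2l (ltW kap0) P3.
have Q5 : u ^+ 2 * (M * X ^+ 2 * 8) / lam <= u ^+ 2 * (kt * n * e).
  by rewrite ler_pdivrMr//; lra.
rewrite [X in _ <= X](_ : _ = kap * (n * e) / 8 * 2 + u ^+ 2 * (kt * n * e) /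
  16 * 2).
  by lra.
by rewrite Ek; field.
Qed.

End BlockNumerics.

(** The edge has squared length [s], tangential part [u * X] and normal part
    [kap * Y], the latter being negligible. *)
Lemma flat_edge {R : realType} (n s u d kap X Y beta w B0 : R) :
  0 < n -> 0 <= beta -> 0 <= w -> n * s = (u * X) ^+ 2 + (kap * Y) ^+ 2 ->
  `|X| <= beta -> `|Y| <= B0 -> kap ^+ 2 * B0 ^+ 2 <= u ^+ 2 * w ^+ 2 ->
  u ^+ 2 <= n * d -> s <= d * (beta + w) ^+ 2.
Proof.
move=> n0 b0 w0 En Xb Yb kw ud.
have B00 : 0 <= B0 by apply: le_trans Yb.
have sq (x y : R) : 0 <= y -> `|x| <= y -> x ^+ 2 <= y ^+ 2.
  by move=> y0 h; rewrite -[leLHS]ger0_norm ?sqr_ge0// normrX lerXn2r ?nnegrE.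
have X2 := ler_wpM2l (sqr_ge0 u) (sq _ _ b0 Xb).
have Y2 := ler_wpM2l (sqr_ge0 kap) (sq _ _ B00 Yb).
have bw : 0 <= u ^+ 2 * (2 * (beta * w)).
  by apply: mulr_ge0; [exact: sqr_ge0|rewrite !mulr_ge0].
have b2 : 0 <= (beta + w) ^+ 2 by exact: sqr_ge0.
have D2 := ler_wpM2r b2 ud.
rewrite -(ler_pM2l n0) En !exprMn; lra.
Qed.

Lemma add_errors {R : realType} (y y0 y1 y2 z e1 e2 e : R) :
  `|y - (y0 + y1 + y2 / 2)| <= e1 -> `|y2 - z| <= e2 -> e1 + e2 / 2 <= e / 2 ->
  `|y - (y0 + (y1 + z / 2))| <= e / 2.
Proof.
by rewrite !ler_norml => /andP[h1 h2] /andP[h3 h4] h5; apply/andP; split; lra.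
Qed.

(** One block of iterations, seen from the end vertex [L] of its first
    triangle. [tau] and [nu] are the tangential and normal coordinates
    multiplied by the length of the gradient at [L]. The model coordinates are
    [X], normalized to be 0 at [L] and 1 at the worst vertex [Q], and [Y], the
    normal coordinate divided by the curvature term [kap], for which f L + kap
    (Y + X^2) approximates [f]. *)
Section Block.
Context {R : realType}.
Variables (f : 'rV[R]_2 -> R) (T : nat -> triangle R) (L W : 'rV[R]_2).
Variables (rho r mu M gam eta lam : R).
Implicit Types (v w : 'rV[R]_2).

Let Q := p3 (T 0%N).
Let D := diam2 (T 0%N).
Let g0 : R := 'D_('e_0) f L.
Let g1 : R := 'D_('e_1) f L.
Let n : R := g0 ^+ 2 + g1 ^+ 2.
Let tau v : R := - g1 * v 0 0 + g0 * v 0 1.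
Let nu v : R := g0 * v 0 0 + g1 * v 0 1.

Hypothesis C2f : C2 f.
Hypothesis curved : forall x v, `|x| <= rho ->
  mu * sqn v <= quad f x v <= M * sqn v.
Hypothesis modulus : forall x y v, `|x| <= rho -> `|y - x| <= r ->
  `|quad f y v - quad f x v| <= eta * sqn v.
Hypothesis step : forall j, rnm_step f (T j) (T j.+1).
Hypothesis ordT : forall j, ordered f (T j).
Hypothesis accT : forall j, accepted f (T j).
Hypothesis LW : (p1 (T 0%N), p2 (T 0%N)) = (L, W) \/ (p1 (T 0%N),
  p2 (T 0%N)) = (W, L).
Hypothesis worst : f Q <= f (reflection (T 0%N)).
Hypothesis farther : sqn (Q - W) <= sqn (Q - L).
Hypothesis inball : [/\ `|L| <= rho, `|W| <= rho, `|Q| <= rho &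
  `|reflection (T 0%N)| <= rho].
Hypothesis steep : gam <= slope2 f L.
Hypothesis pos : [/\ 0 < mu, 0 < M, 0 < gam & 0 < D].

Let tauB v w : tau (v - w) = tau v - tau w.
Proof. by rewrite /tau !mxE; ring. Qed.

Let nuB v w : nu (v - w) = nu v - nu w.
Proof. by rewrite /nu !mxE; ring. Qed.

Let frame v : n * sqn v = tau v ^+ 2 + nu v ^+ 2.
Proof. by rewrite /n /sqn /tau /nu; ring. Qed.

Let n_gt0 : 0 < n.
Proof. by case: pos => _ _ gam0 _; exact: lt_le_trans steep. Qed.

Let edges : [/\ sqn (Q - L) <= D, sqn (W - L) <= D & sqn (Q - W) <= D].
Proof.
have [e12 e13 e23] := diam2_edges (T 0%N); rewrite -/Q -/D in e12 e13 e23.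
move: e12 e13 e23; case: LW => -[-> ->] e12 e13 e23.
  by split; rewrite sqnN// sqnN.
by split; rewrite // sqnN.
Qed.

(** The reflected point is no better than [Q], while to first order the values
    of [Q] and of its reflection average to that of the midpoint. So the values
    at the vertices differ by O(M D), hence so do their normal coordinates. *)
Lemma normal_bound : [/\ `|nu (Q - L)| <= M * D * 2,
  `|nu (W - L)| <= M * D * 2 &
  `|nu (Q - W)| <= M * D * 2].
Proof.
case: pos => mu0 M0 _ _; case: inball => hL hW hQ hR.
have MD : 0 <= M * D by apply: mulr_ge0; [exact: ltW|exact: diam2_ge0].
have hw := worst; set Rf := reflection (T 0%N) in hR hw.
have gr v : grad f L v = nu v by rewrite /grad /nu /g0 /g1; ring.
have sR : sqn (Rf - L) <= D.
  case: edges => _ _; apply: le_trans; rewrite le_eqVlt; apply/orP; left;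
    apply/eqP.
  rewrite /Rf /reflection /midpoint /sqn -/Q.
  by case: LW => -[-> ->]; rewrite !mxE; field.
have nR : nu (Rf - L) = nu (W - L) - nu (Q - L).
  rewrite /Rf /reflection /midpoint /nu -/Q.
  by case: LW => -[-> ->]; rewrite !mxE; field.
have lower v : `|v| <= rho -> f L + nu (v - L) <= f v.
  move=> hv; have := above_tangent C2f curved hL hv; rewrite gr.
  have : 0 <= mu / 2 * sqn (v - L) by apply: mulr_ge0 (sqn_ge0 _);
    rewrite divr_ge0// ltW.
  lra.
have upper v : `|v| <= rho -> sqn (v - L) <= D ->
  f v <= f L + nu (v - L) + M / 2 * D.
  move=> hv hs; have := below_tangent C2f curved hL hv; rewrite gr.
  have M2 : 0 <= M / 2 by rewrite divr_ge0// ltW.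
  have := ler_wpM2l M2 hs; lra.
have /andP[le12 le23] := ordT 0%N; rewrite -/Q in le23.
have [fL fW] : f L <= f Q /\ f W <= f Q.
  by move: le12 le23; case: LW => -[-> ->] h1 h2; split=> //;
    exact: le_trans h2.
have [eQ eW _] := edges.
have := lower _ hQ; have := lower _ hW; have := upper _ hQ eQ;
  have := upper _ hR sR.
have -> : nu (Q - W) = nu (Q - L) - nu (W - L) by rewrite !nuB; ring.
rewrite nR; move: (nu (Q - L)) (nu (W - L)) (f L) (f W) (f Q) (f Rf) fL fW hw
  MD.
move=> y w a b c h ac bc ch MD h1 h2 h3 h4.
by split; rewrite ler_norml; apply/andP; split; lra.
Qed.

(** Length O(sqrt D) along the level curve times height O(D). *)
Lemma det2_upper : gam * det2 (T 0%N) <= 16 * M ^+ 2 * D ^+ 3.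
Proof.
have [nQ nW _] := normal_bound; have [eQ eW _] := edges.
case: pos => _ M0 _ D0.
have sq (x : R) : `|x| <= M * D * 2 -> x ^+ 2 <= (M * D * 2) ^+ 2.
  move=> h; have y0 : 0 <= M * D * 2 by apply: le_trans h.
  by rewrite -[leLHS]ger0_norm ?sqr_ge0// normrX lerXn2r ?nnegrE.
have tau_le v : sqn v <= D -> tau v ^+ 2 <= n * D.
  move=> h; apply: (@le_trans _ _ (n * sqn v)); last by rewrite ler_wpM2l// ltW.
  by rewrite frame lerDl sqr_ge0.
have -> : det2 (T 0%N) = cross (W - L) (Q - L) ^+ 2.
  by rewrite /det2 /cross -/Q; case: LW => -[-> ->]; rewrite !mxE; ring.
apply: (@le_trans _ _ (n * cross (W - L) (Q - L) ^+ 2)).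
  by rewrite ler_wpM2r ?sqr_ge0.
rewrite -(ler_pM2l n_gt0).
have -> : n * (n * cross (W - L) (Q - L) ^+ 2) =
    (nu (W - L) * tau (Q - L) - nu (Q - L) * tau (W - L)) ^+ 2.
  by rewrite /n /cross /nu /tau; ring.
have a1 := ler_pM (sqr_ge0 _) (sqr_ge0 _) (sq _ nW) (tau_le _ eQ).
have a2 := ler_pM (sqr_ge0 _) (sqr_ge0 _) (sq _ nQ) (tau_le _ eW).
move: a1 a2; have := sqr_ge0 (nu (W - L) * tau (Q - L) + nu (Q - L) * tau (W -
  L)).
move: (nu (W - L)) (tau (Q - L)) (nu (Q - L)) (tau (W - L)) => a b c d h1 h2
  h3; lra.
Qed.

Let u := tau (Q - L).

Hypothesis small1 : 64 * M ^+ 2 * D <= gam.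

Let nu2_small : nu (Q - L) ^+ 2 * 16 <= n * D.
Proof.
have [h _ _] := normal_bound; case: pos => _ _ _ D0.
have h2 : nu (Q - L) ^+ 2 <= (M * D * 2) ^+ 2.
  have y0 : 0 <= M * D * 2 by apply: le_trans h.
  by rewrite -[leLHS]ger0_norm ?sqr_ge0// normrX lerXn2r ?nnegrE.
have : (64 * M ^+ 2 * D) * D <= n * D.
  by rewrite ler_wpM2r ?(ltW D0)//; apply: le_trans small1 steep.
lra.
Qed.

(** The triangle is nearly parallel to the level curve, and [Q - L] is
    comparable to its longest edge. *)
Lemma tangential_lower : n * D <= 8 * u ^+ 2.
Proof.
have D4 : D <= 4 * sqn (Q - L).
  have s0 := sqn_ge0 (Q - L); have sW : sqn (W - L) <= 4 * sqn (Q - L).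
    have := farther; have := sqn_ge0 (Q - L - (W - Q)); rewrite /sqn !mxE; lra.
  rewrite /D diam2_le -/Q; case: LW => -[-> ->].
    by rewrite (sqnN L W) (sqnN L Q) (sqnN W Q) sW; have := farther; lra.
  by rewrite (sqnN L Q) (sqnN W Q) sW; have := farther; lra.
have := ler_wpM2l (ltW n_gt0) D4; rewrite mulrCA; have := nu2_small.
have := sqr_ge0 u; have := frame (Q - L); rewrite -/u;
  move: (n * D) (n * sqn _) => a b; lra.
Qed.

Hypothesis r_gt0 : 0 < r.
Hypothesis eta_ge0 : 0 <= eta.
Hypothesis lam_gt0 : 0 < lam.

(* Within 23 iterations an affine coordinate that starts within e stays within
   25 e; X starts within 3 and Y within B0. *)
Let B0 : R := 32 * M / mu.
Let B2 : R := (25 * B0) ^+ 2.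
Let w : R := (zr 20000%ZZ)^-1.

Hypothesis eta_small : 8 * eta * 75 ^+ 2 <= mu * margin.
Hypothesis lam_large : 8 * M * 75 ^+ 2 <= lam * (mu * margin).
Hypothesis small2 : 2 * eta * M * B2 * D <= gam * margin.
Hypothesis small3 : 2 * (1 + lam) * M ^+ 2 * B2 * D <= gam * margin.
Hypothesis small4 : M ^+ 2 * B0 ^+ 2 * D <= 4 * gam * w ^+ 2.
Hypothesis small5 : 2 * 75 ^+ 2 * D <= r ^+ 2.
Hypothesis small6 : M ^+ 2 * B2 * D ^+ 2 <= 2 * gam * r ^+ 2.

Let H := hessian f L.
Let q (x y : R) := H 0 0 * x ^+ 2 + (H 0 1 + H 1 0) * (x * y) + H 1 1 * y ^+ 2.
Let kt : R := q (- g1) g0 / n ^+ 2.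
Let kap : R := kt * u ^+ 2 / 2.
Let X v := tau (v - L) / u.
Let Y v := nu (v - L) / kap.

Let quadq v : quad f L v = q (v 0 0) (v 0 1).
Proof. by rewrite quadE /q -/H; ring. Qed.

Let q_bound x y : mu * (x ^+ 2 + y ^+ 2) <= q x y <= M * (x ^+ 2 + y ^+ 2).
Proof.
pose v : 'rV[R]_2 := \row_(i < 2) (if i == 0 then x else y).
have [v0 v1] : v 0 0 = x /\ v 0 1 = y by rewrite !mxE.
by case: inball => hL _ _ _; have := curved v hL; rewrite quadq /sqn v0 v1.
Qed.

Let kt_bound : mu <= kt * n /\ kt * n <= M.
Proof.
have nN : n != 0 by rewrite gt_eqF.
have -> : kt * n = q (- g1) g0 / n by rewrite /kt; field.
have := q_bound (- g1) g0; rewrite sqrrN [_ ^+ 2 + _]addrC -/n => /andP[h1 h2].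
by split; rewrite ?ler_pdivlMr// ?ler_pdivrMr.
Qed.

Let u2_le : u ^+ 2 <= n * D.
Proof.
have [e1 _ _] := edges; apply: (@le_trans _ _ (n * sqn (Q - L))).
  by rewrite frame -/u lerDl sqr_ge0.
by rewrite ler_wpM2l// ltW.
Qed.

Let kt_gt0 : 0 < kt.
Proof.
have [h _] := kt_bound; case: pos => mu0 _ _ _.
by rewrite -(@pmulr_lgt0 _ n)//; exact: lt_le_trans h.
Qed.

Let kap_le : kap <= M * D / 2.
Proof.
have [_ h] := kt_bound; case: pos => mu0 M0 _ D0.
have := ler_wpM2l (ltW kt_gt0) u2_le; have := ler_wpM2r (ltW D0) h.
by rewrite /kap; lra.
Qed.

Let kap_ge : mu * D <= 16 * kap.
Proof.
have [h _] := kt_bound; case: pos => mu0 M0 _ D0.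
have := ler_wpM2l (ltW kt_gt0) tangential_lower; have := ler_wpM2r (ltW D0) h.
by rewrite /kap; lra.
Qed.

Let kap_gt0 : 0 < kap.
Proof.
case: pos => mu0 _ _ D0; have := mulr_gt0 mu0 D0; have := kap_ge; lra.
Qed.

Let u_neq0 : u != 0.
Proof.
apply/eqP => u0; move: kap_gt0; rewrite /kap u0 expr0n mulr0 mul0r; lra.
Qed.

Let tauX v : tau (v - L) = u * X v.
Proof. by rewrite /X mulrC divfK. Qed.

Let nuY v : nu (v - L) = kap * Y v.
Proof. by rewrite /Y mulrC divfK// gt_eqF. Qed.

Let affX : affine X.
Proof. by move=> c v v'; rewrite /X /tau !mxE; field. Qed.

Let affY : affine Y.
Proof. by move=> c v v'; rewrite /Y /nu !mxE; field; rewrite gt_eqF. Qed.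

Let XL : X L = 0.
Proof. by rewrite /X tauB subrr mul0r. Qed.

Let YL : Y L = 0.
Proof. by rewrite /Y nuB subrr mul0r. Qed.

Let XQ : X Q = 1.
Proof. by rewrite /X divff. Qed.

Let XW : - (1 / 4) <= X W /\ X W <= 9 / 4.
Proof.
have E : tau (Q - W) = u * (1 - X W) by rewrite !tauB mulrBr mulr1 -tauX /u
  !tauB; ring.
have h : n * sqn (Q - W) <= n * sqn (Q - L) by rewrite ler_wpM2l// ltW.
move: h; rewrite !frame E -/u => h.
have k : u ^+ 2 * (1 - X W) ^+ 2 <= u ^+ 2 * (3 / 2).
  have := tangential_lower; have := nu2_small; have := sqr_ge0 (nu (Q - W));
    lra.
have u2 : 0 < u ^+ 2 by rewrite exprn_even_gt0.
by move: k; rewrite ler_pM2l// => k; split; nra.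
Qed.

Let margin_gt0 : 0 < @margin R.
Proof. by have /andP[] := @zr_inv_le R 10000%ZZ isT. Qed.

Let w_gt0 : 0 < w.
Proof. by have /andP[] := @zr_inv_le R 20000%ZZ isT. Qed.

Let B0_ge0 : 0 <= B0.
Proof. by case: pos => mu0 M0 _ _; rewrite /B0 divr_ge0 ?mulr_ge0// ltW. Qed.

Let G v : Prop := `|X v| <= 75 /\ `|Y v| <= 25 * B0.

Let sq_le (x y : R) : `|x| <= y -> x ^+ 2 <= y ^+ 2.
Proof.
move=> h; have y0 : 0 <= y by apply: le_trans h.
by rewrite -[leLHS]ger0_norm ?sqr_ge0// normrX lerXn2r ?nnegrE.
Qed.

Let G_near v : G v -> `|v - L| <= r.
Proof.
move=> [/sq_le hX /sq_le hY]; apply: norm_le_of_sqn; first exact: ltW.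
rewrite -(ler_pM2l n_gt0) frame tauX nuY (exprMn _ u) (exprMn _ kap).
have k2 : kap ^+ 2 <= (M * D / 2) ^+ 2 by apply: sq_le; rewrite gtr0_norm.
have a1 := ler_wpM2l (sqr_ge0 u) hX.
have a2 := ler_wpM2r (sqr_ge0 75) u2_le.
have a3 := ler_wpM2l (ltW n_gt0) small5.
have a4 := ler_pM (sqr_ge0 kap) (sqr_ge0 (Y v)) k2 hY.
have a5 : gam * r ^+ 2 <= n * r ^+ 2 by rewrite ler_wpM2r ?sqr_ge0.
by move: a4 small6; rewrite -/B2; lra.
Qed.

Let model_error v : G v ->
  `|f v - (f L + kap * (Y v + X v ^+ 2))| <= kap * margin / 2.
Proof.
move=> Gv; have [hX hY] := Gv; case: inball => hL _ _ _;
  case: pos => mu0 M0 gam0 D0.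
have expand := second_order_expansion C2f modulus hL (G_near Gv).
have grE : grad f L (v - L) = kap * Y v.
  by rewrite -nuY /grad /nu -/g0 -/g1; ring.
have hq x y : 0 <= q x y <= M * (x ^+ 2 + y ^+ 2).
  have /andP[h1 ->] := q_bound x y; rewrite andbT; apply: le_trans h1.
  by apply: mulr_ge0 (ltW mu0) _; rewrite addr_ge0 ?sqr_ge0.
have split := quad_split ((v - L) 0 0) ((v - L) 0 1) hq lam_gt0 n_gt0.
rewrite -/(q _ _) -quadq -/(tau (v - L)) -/(nu (v - L)) -/n -/(q _ _) -/kt in
  split.
rewrite tauX nuY in split.
have sE : sqn (v - L) = ((u * X v) ^+ 2 + (kap * Y v) ^+ 2) / n.
  by rewrite -tauX -nuY -frame mulrC mulKf// gt_eqF.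
rewrite grE sE (addrC L) subrK in expand.
have [mk _] := kt_bound.
have rest := rest_bound n_gt0 lam_gt0 margin_gt0 eta_ge0 (ltW M0) kap_gt0 steep
  (erefl kap) mk
  kap_le (sq_le hX) (sq_le hY) (ltW D0) eta_small lam_large small2 small3.
have kX : kap * X v ^+ 2 = kt * (u * X v) ^+ 2 / 2 by rewrite /kap; field.
by rewrite (mulrDr kap) kX; exact: add_errors expand split rest.
Qed.

Let compare v v' : G v -> G v' -> f v <= f v' ->
  Y v + X v ^+ 2 <= Y v' + X v' ^+ 2 + margin.
Proof.
move=> /model_error h /model_error h' le; rewrite -(ler_pM2l kap_gt0).
move: h h' le; rewrite [kap * (_ + margin)]mulrDr.
move: (kap * (Y v + _)) (kap * (Y v' + _)) (kap * margin) (f v) (f v') (f L).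
move=> a b km fv fv' fL; rewrite !ler_norml => /andP[h1 h2] /andP[h3 h4] h5;
  lra.
Qed.

Let kap_flat : kap ^+ 2 * B0 ^+ 2 <= u ^+ 2 * w ^+ 2.
Proof.
have [_ kM] := kt_bound; case: pos => mu0 M0 gam0 D0.
have b2 := sqr_ge0 B0; have w2 := sqr_ge0 w; have k0 := ltW kap_gt0.
have h1 : kap * (kt * n) <= M * D / 2 * M.
  by apply: ler_pM => //; rewrite mulr_ge0// ltW.
have h2 := ler_wpM2r b2 h1.
have h3 : gam * w ^+ 2 <= n * w ^+ 2 by rewrite ler_wpM2r.
have h4 : kap * kt * B0 ^+ 2 / 2 <= w ^+ 2.
  by rewrite -(ler_pM2l n_gt0); move: small4; lra.
have E : kap ^+ 2 = kap * (kt * u ^+ 2 / 2) by rewrite expr2.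
have := ler_wpM2l (sqr_ge0 u) h4; rewrite E.
by move: kap kt u B0 w => a b c d e; lra.
Qed.

Let kind j := rnm_step_kind (ordT j) (accT j) (step j).

Let edge_X : edge_bound X (T 0%N) 3 /\ `|X (p1 (T 0%N))| <= 3.
Proof.
have [W0 W2] := XW; rewrite /edge_bound -/Q.
by case: LW => -[-> ->]; rewrite XL XQ !ler_norml; do ?split;
  apply/andP; split; lra.
Qed.

Let edge_Y : edge_bound Y (T 0%N) B0 /\ `|Y (p1 (T 0%N))| <= B0.
Proof.
have [nQ nW nQW] := normal_bound; case: pos => mu0 M0 _ D0.
have yb x : `|x| <= M * D * 2 -> `|x / kap| <= B0.
  move=> hx; rewrite normrM normfV (gtr0_norm kap_gt0) ler_pdivrMr// /B0.
  apply: (le_trans hx); rewrite [leRHS]mulrAC ler_pdivlMr//.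
  by have := ler_wpM2l (ltW M0) kap_ge; lra.
have yQ : `|Y Q| <= B0 by exact: yb.
have yW : `|Y W| <= B0 by exact: yb.
have yQW : `|Y Q - Y W| <= B0.
  by rewrite /Y -mulrBl -nuB opprB addrA subrK; exact: yb.
rewrite /edge_bound -/Q; case: LW => -[-> ->];
  rewrite YL ?subr0 ?sub0r ?normrN ?normr0;
  by split; [split=> //; rewrite distrC|].
Qed.

Lemma block_shape_growth : exists i,
  101 ^+ 2 * det2 (T 0%N) * diam2 (T i) ^+ 3 <=
    100 ^+ 2 * det2 (T i) * diam2 (T 0%N) ^+ 3.
Proof.
have [eX pX] := edge_X; have [eY pY] := edge_Y.
have inG j : (j <= 23)%N ->
    [/\ G (p1 (T j)), G (p2 (T j)), G (p3 (T j)) & G (reflection (T j))].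
  move=> j23; have [_ bX] := affine_orbit affX kind eX pX j;
    have [_ bY] := affine_orbit affY kind eY pY j.
  have cap (e x : R) : 0 <= e -> `|x| <= e *+ j.+2 -> `|x| <= 25 * e.
    move=> e0 h; apply: le_trans h _; rewrite mulr_natl.
    by apply: ler_wpMn2l; rewrite // !ltnS.
  have GG v : v = p1 (T j) \/ v = p2 (T j) \/ v = p3 (T j) \/ v = reflection (T
    j) -> G v.
    move=> hv; split; last exact: cap (bY v hv).
    by rewrite (_ : 75 = 25 * 3); [exact: cap (bX v hv)|ring].
  by split; apply: GG; [left|right; left|right; right; left|right; right;
    right].
have [i _ [beta [beta0 bX grow]]] :=
  model_growth affX affY compare inG step accT ordT
  (leqnn 23) worst LW XQ XL YL (proj1 XW).
exists i; have [bY _] := affine_orbit affY kind eY pY i.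
have flat v v' : `|X v - X v'| <= beta -> `|Y v - Y v'| <= B0 ->
    sqn (v - v') <= D * (beta + w) ^+ 2.
  move=> hX hY; apply: (flat_edge n_gt0 beta0 (ltW w_gt0) _ hX hY kap_flat
    u2_le).
  rewrite frame !mulrBr -!tauX -!nuY !tauB !nuB.
  by congr (_ ^+ 2 + _ ^+ 2); ring.
have dT : diam2 (T i) <= D * (beta + w) ^+ 2.
  case: bX => x1 x2 x3; case: bY => y1 y2 y3.
  by rewrite diam2_le !flat.
have d0 : 0 <= 101 ^+ 2 * det2 (T 0%N) by rewrite mulr_ge0 ?sqr_ge0// det2_ge0.
apply: (@le_trans _ _ (101 ^+ 2 * det2 (T 0%N) * (D * (beta + w) ^+ 2) ^+ 3)).
  apply: ler_wpM2l => //; rewrite lerXn2r// nnegrE; first exact: diam2_ge0.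
  exact: mulr_ge0 (diam2_ge0 _) (sqr_ge0 _).
have D30 : 0 <= D ^+ 3 by rewrite exprn_ge0// diam2_ge0.
have := ler_wpM2l D30 grow; rewrite -/w; move: (beta + w) => s h.
by move: h; rewrite -/D; lra.
Qed.

End Block.

(** * Convergence *)

(** This bundles the smallness conditions on the diameter. *)
Lemma small_multiple {R : realType} (c d : R) : 0 < d ->
  exists2 del : R, 0 < del & forall D, 0 <= D <= del -> c * D <= d.
Proof.
move=> d0; pose k := `|c| + 1; have k0 : 0 < k by rewrite ltr_wpDl.
exists (d / k); first by rewrite divr_gt0.
move=> D /andP[D0 Dd]; apply: (@le_trans _ _ (k * D)).
  by apply: ler_wpM2r => //; apply: le_trans (ler_norm c) _; rewrite lerDl.
by rewrite mulrC -ler_pdivlMr.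
Qed.

Section Contradiction.
Context {R : realType}.
Variables (f : 'rV[R]_2 -> R) (T : nat -> triangle R) (z : 'rV[R]_2).
Hypothesis cf : classF f.
Hypothesis run : rnm_run f T.
Hypothesis minz : minimizer f z.

(** The block starts from the triangle formed by the two retained vertices and
    the point [q] of the contraction, of the same shape as the actual one and
    with the same successor. The vertex [L] is the retained one farther from
    [q]. *)
Lemma contraction_growth (al : R) : f z < al ->
  (forall k, al <= f (p1 (T k))) ->
  exists del C : R, [/\ 0 < del, 0 < C & forall k, contracts f (T k) (T k.+1) ->
    diam2 (T k) <= del ->
    det2 (T k) <= C * diam2 (T k) ^+ 3 /\
    exists2 m, (k <= m)%N & 101 ^+ 2 * det2 (T k) * diam2 (T m) ^+ 3 <=
      100 ^+ 2 * det2 (T m) * diam2 (T k) ^+ 3].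
Proof.
move=> fz hal; have [C2f _ _] := cf.
have [rho0 [rho00 bnd0]] := run_bounded cf run.
pose rho := Num.max rho0 `|z|.
have rho_ge0 : 0 <= rho by rewrite le_max rho00.
have hz : `|z| <= rho by rewrite le_max lexx orbT.
have bnd k : [/\ `|p1 (T k)| <= rho, `|p2 (T k)| <= rho, `|p3 (T k)| <= rho &
    `|reflection (T k)| <= rho].
  by have [h1 h2 h3 h4] := bnd0 k; split; rewrite le_max ?h1 ?h2 ?h3 ?h4.
have [mu [M [mu0 M0 curved]]] := hessian_bounds rho_ge0 cf.
have [gam gam0 steep] := slope2_lower_bound cf rho_ge0 hz fz.
have e0 : 0 < @margin R by have /andP[] := @zr_inv_le R 10000%ZZ isT.
have w0 : 0 < (zr 20000%ZZ : R)^-1 by have /andP[] := @zr_inv_le R 20000%ZZ isT.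
have growth := @block_shape_growth R f.
move: margin e0 ((zr 20000%ZZ)^-1) w0 growth => e e0 w w0 growth.
pose eta := mu * e / (8 * 75 ^+ 2).
have eta0 : 0 < eta by rewrite divr_gt0 ?mulr_gt0 ?exprn_gt0.
pose lam := 8 * M * 75 ^+ 2 / (mu * e).
have lam0 : 0 < lam by rewrite divr_gt0 ?mulr_gt0 ?exprn_gt0.
have [r r0 modulus] := hessian_modulus rho C2f eta0.
pose B0 := 32 * M / mu; pose B2 := (25 * B0) ^+ 2.
have ge0 : 0 < gam * e by rewrite mulr_gt0.
have r20 : 0 < r ^+ 2 by rewrite exprn_gt0.
have gw0 : 0 < 4 * gam * w ^+ 2 by rewrite !mulr_gt0// exprn_gt0.
have gr0 : 0 < 2 * gam * r ^+ 2 by rewrite !mulr_gt0.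
have [d1 d10 s1] := small_multiple (64 * M ^+ 2) gam0.
have [d2 d20 s2] := small_multiple (2 * eta * M * B2) ge0.
have [d3 d30 s3] := small_multiple (2 * (1 + lam) * M ^+ 2 * B2) ge0.
have [d4 d40 s4] := small_multiple (M ^+ 2 * B0 ^+ 2) gw0.
have [d5 d50 s5] := small_multiple (2 * 75 ^+ 2) r20.
have [d6 d60 s6] := small_multiple (M ^+ 2 * B2) gr0.
pose del := Num.min (Num.min (Num.min d1 d2) (Num.min d3 d4)) (Num.min (Num.min
  d5 d6) 1).
exists del, (16 * M ^+ 2 / gam); split.
- by rewrite !lt_min d10 d20 d30 d40 d50 d60 ltr01.
- by rewrite divr_gt0// mulr_gt0// exprn_gt0.
move=> k hc; rewrite !le_min => /andP[/andP[/andP[D1 D2] /andP[D3 D4]]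
  /andP[/andP[D5 D6] D7]].
have Dge0 := diam2_ge0 (T k).
have /andP[le12 le23] := run_ordered cf run k.
have [q [hq bq qc qr E]] := hc.
pose V := Triangle (p1 (T k)) (p2 (T k)) q.
have dV : diam2 V = diam2 (T k) by rewrite /V; case: hq => -> //;
  rewrite diam2_reflected.
have detV : det2 V = det2 (T k).
  case: hq => h; rewrite /V h //.
  by rewrite -(det2_reflection f (T k)) det2_insert.
have ordV : ordered f V by rewrite /ordered /= le12.
have ndk : det2 (T k) != 0 by have [] := run_invariant cf run k.
have accV : accepted f V by apply: accepted_classF => //; rewrite detV.
have stepV : rnm_step f V (T k.+1).
  move: accV; rewrite /rnm_step /accepted -/(reflection V) !ltNge /= qr
    (le_trans bq qr) /=.
  by case: ifP => // _ _; rewrite E.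
pose T' j := if j is j'.+1 then T (k + j'.+1)%N else V.
have [_ _ st] := run.
have step' j : rnm_step f (T' j) (T' j.+1).
  case: j => [|j]; first by rewrite /T' addn1.
  by rewrite /T' [(k + j.+2)%N]addnS; exact: st.
have ord' j : ordered f (T' j) by case: j => [//|j];
  exact: (run_ordered cf run).
have acc' j : accepted f (T' j) by case: j => [//|j];
  exact: (run_accepted cf run).
have [b1 b2 b3 br] := bnd k.
have bq' : `|q| <= rho by case: hq => ->.
have brV : `|reflection V| <= rho by rewrite /V; case: hq => -> //;
  rewrite reflectionK.
have D0 : 0 < diam2 V.
  rewrite lt_neqAle diam2_ge0 andbT eq_sym; apply: contra ndk => /eqP d0.
  have := det2_le_edge V; rewrite d0 mulr0 detV => h.
  by rewrite eq_le h det2_ge0.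
have pos : [/\ 0 < mu, 0 < M, 0 < gam & 0 < diam2 (T' 0%N)] by [].
have eta_small : 8 * eta * 75 ^+ 2 <= mu * e.
  by rewrite mulrAC mulrC /eta divfK// mulf_neq0 ?expf_neq0 ?pnatr_eq0.
have lam_large : 8 * M * 75 ^+ 2 <= lam * (mu * e).
  by rewrite /lam divfK// gt_eqF// mulr_gt0.
have small x (h : diam2 (T k) <= x) : 0 <= diam2 (T' 0%N) <= x by rewrite /T'
  dV Dge0.
have sq6 : M ^+ 2 * B2 * diam2 (T' 0%N) ^+ 2 <= 2 * gam * r ^+ 2.
  apply: le_trans (s6 _ (small _ D6)); apply: ler_wpM2l.
    by rewrite mulr_ge0 ?sqr_ge0.
  by rewrite /T' dV expr2 ler_piMl.
(* The slope at either retained vertex is bounded below, so L may be chosen by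
   distance. *)
have choice : exists L W, [/\ (p1 V, p2 V) = (L, W) \/ (p1 V, p2 V) = (W, L),
    sqn (q - W) <= sqn (q - L), [/\ `|L| <= rho, `|W| <= rho, `|q| <= rho &
      `|reflection V| <= rho] & gam <= slope2 f L].
  have [h|h] := leP (sqn (q - p2 V)) (sqn (q - p1 V)).
    by exists (p1 V), (p2 V); split => //; [left|exact: (steep _ b1 (hal k))].
  exists (p2 V), (p1 V); split => //; [by right|exact: ltW|].
  exact: (steep _ b2 (le_trans (hal k) le12)).
have [L [W [LW far ball st_L]]] := choice.
split.
  have := @det2_upper R f T' L W rho mu M gam C2f curved ord' LW qr ball st_L
    pos.
  rewrite /T' dV detV => h; rewrite mulrAC ler_pdivlMr// [leLHS]mulrC.
  exact: h.
have [i] := growth T' L W rho r mu M gam eta lam C2f curved modulus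
  step' ord' acc' LW qr far ball st_L pos (s1 _ (small _ D1)) r0 (ltW eta0) lam0
  eta_small lam_large (s2 _ (small _ D2)) (s3 _ (small _ D3)) (s4 _ (small _
    D4))
  (s5 _ (small _ D5)) sq6.
rewrite {1 4}/T' dV detV; case: i => [|i] h.
  by exists k => //; move: h; rewrite /T' dV detV.
by exists (k + i.+1)%N => //; exact: leq_addr.
Qed.

Let flatness k := det2 (T k) / diam2 (T k) ^+ 3.

Let diam2_gt0 k : 0 < diam2 (T k).
Proof.
have [_ nd] := run_invariant cf run k.
rewrite lt_neqAle diam2_ge0 andbT eq_sym; apply: contra nd => /eqP d0.
by have := det2_le_edge (T k); rewrite d0 mulr0 => h; rewrite eq_le h det2_ge0.
Qed.

Let flatness_gt0 k : 0 < flatness k.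
Proof.
have [_ nd] := run_invariant cf run k.
apply: divr_gt0; last exact: exprn_gt0.
by rewrite lt_neqAle eq_sym nd det2_ge0.
Qed.

Let next_contraction m :
  exists j, [/\ (m <= j)%N,
    contracts f (T j) (T j.+1) & flatness j = flatness m].
Proof.
have [k mk hc] := contracts_infinitely_often cf run minz m.
rewrite -(subnK mk) in hc; move: (k - m)%N hc => {k mk} d.
elim: d m => [|d IH] m hc; first by exists m.
have [hr|hc'] := run_kind cf run m; last by exists m.
have [j [mj cj Ej]] := IH m.+1 ltac:(by rewrite addnS -addSn).
exists j; split => //; first exact: ltnW.
by rewrite Ej /flatness; have [-> ->] := reflects_shape hr.
Qed.

(** The ratio increases by at least 1/100 of its first value from one
    contraction to a later one, although it is bounded at contractions. *)
Lemma limit_value_minimal (al : R) : f z <= al ->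
  (forall k, al <= f (p1 (T k))) ->
  (forall e : R, 0 < e -> exists K, forall k, (K <= k)%N -> diam2 (T k) <= e) ->
  al = f z.
Proof.
move=> zal hal small; apply/eqP; rewrite eq_le zal andbT leNgt;
  apply/negP => fz.
have [del [C [del0 C0 growth]]] := contraction_growth fz hal.
have [K hK] := small _ del0.
have [k0 [Kk0 c0 _]] := next_contraction K.
have climb N : exists k, [/\ (K <= k)%N, contracts f (T k) (T k.+1) &
    flatness k0 + flatness k0 * (N%:R / 100) <= flatness k].
  elim: N => [|N [k [Kk ck IH]]]; first by exists k0; rewrite mul0r mulr0 addr0.
  have [_ [m km hm]] := growth k ck (hK k Kk).
  have [j [mj cj Ej]] := next_contraction m.
  exists j; split => //; first by rewrite (leq_trans Kk)// (leq_trans km).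
  rewrite Ej; apply: (@le_trans _ _ (101 ^+ 2 / 100 ^+ 2 * flatness k)).
    have N0 : 0 <= flatness k0 * (N%:R / 100).
      by rewrite mulr_ge0 ?(ltW (flatness_gt0 _))// divr_ge0.
    by rewrite -natr1; have := flatness_gt0 k0; lra.
  rewrite /flatness ler_pdivlMr ?exprn_gt0//.
  rewrite -(ler_pM2l (_ : 0 < 100 ^+ 2 :> R)) ?exprn_gt0//.
  have d0 : diam2 (T k) ^+ 3 != 0 by rewrite expf_neq0// gt_eqF.
  rewrite -(ler_pM2r (exprn_gt0 3 (diam2_gt0 k))).
  apply: le_trans hm; rewrite le_eqVlt; apply/orP; left; apply/eqP.
  by field; rewrite gt_eqF.
pose N := Num.Def.archi_bound (100 * C / flatness k0).
have hN : 100 * C / flatness k0 < N%:R.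
  apply: archi_boundP; apply: divr_ge0; last exact: ltW.
  by rewrite mulr_ge0// ltW.
have [k [Kk ck hk]] := climb N.
have [up _] := growth k ck (hK k Kk).
have : flatness k <= C by rewrite /flatness ler_pdivrMr// exprn_gt0.
move: hN; rewrite ltr_pdivrMr//; have := flatness_gt0 k0; lra.
Qed.

End Contradiction.

Section Convergence.
Context {R : realType}.
Variables (f : 'rV[R]_2 -> R) (T : nat -> triangle R) (z : 'rV[R]_2).
Hypothesis cf : classF f.
Hypothesis run : rnm_run f T.
Hypothesis minz : minimizer f z.

Lemma vertex_cvg (p : triangle R -> 'rV[R]_2) :
  (forall k, f (p (T k)) <= f (p3 (T k))) ->
  (exists rho : R, forall k, `|p (T k)| <= rho) ->
  (forall e : R, 0 < e -> exists K, forall k, (K <= k)%N ->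
    f (p3 (T k)) <= f z + e) ->
  p (T k) @[k --> \oo] --> z.
Proof.
move=> pw [rho0 bnd] lim; have [C2f _ _] := cf.
pose rho := Num.max rho0 `|z|.
have rho_ge0 : 0 <= rho by rewrite le_max normr_ge0 orbT.
have [mu [M [mu0 _ curved]]] := hessian_bounds rho_ge0 cf.
apply/cvgrPdist_le => e e0.
have e1 : 0 < mu / 8 * e ^+ 2 by rewrite mulr_gt0 ?exprn_gt0// divr_gt0.
have [K hK] := lim _ e1; exists K => // k /= /hK hk.
apply: norm_le_of_sqn; first exact: ltW.
have hz : `|z| <= rho by rewrite le_max lexx orbT.
have hp : `|p (T k)| <= rho by rewrite le_max bnd.
have := midpoint_value cf curved (ltW mu0) hz hp.
have := minz (midpoint z (p (T k))); have := pw k => h1 h2 h3.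
have mu16 : 0 < mu / 16 by rewrite divr_gt0.
rewrite -(ler_pM2l mu16); lra.
Qed.

Lemma run_converges : rnm_converges_to T z.
Proof.
have [al [zal hal lim]] := run_common_limit cf run minz.
have small (e : R) : 0 < e -> exists K, forall k, (K <= k)%N ->
  diam2 (T k) <= e.
  by move=> /lim[K hK]; exists K => k /hK[].
have E := limit_value_minimal cf run minz zal hal small.
have {}lim (e : R) : 0 < e -> exists K, forall k, (K <= k)%N ->
  f (p3 (T k)) <= f z + e.
  by move=> /lim[K hK]; exists K => k /hK[]; rewrite E.
have [rho [_ bnd]] := run_bounded cf run.
split; apply: vertex_cvg => //.
- by move=> k; have /andP[h1 h2] := run_ordered cf run k; apply: le_trans h1 h2.
- by exists rho => k; have [] := bnd k.
- by move=> k; have /andP[] := run_ordered cf run k.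
- by exists rho => k; have [] := bnd k.
- by exists rho => k; have [] := bnd k.
Qed.

End Convergence.

Theorem theorem1p2 (R : realType) (f : 'rV[R]_2 -> R) (hf : classF f) :
  exists z : 'rV[R]_2,
    unique (minimizer f) z /\
    forall T : nat -> triangle R, rnm_run f T -> rnm_converges_to T z.
Proof.
have [z uz] := exists_minimizer hf; exists z; split => // T run.
by apply: (run_converges hf run); case: uz.
Qed.
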